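(* Let $0<\lambda<\mu_1<\mu_2$, $\rho_2=\lambda/\mu_2$, let $\eta\in(0,1)$ be the unique zero in $(0,1)$ of $\tau(z)=-\lambda-\mu_1-\mu_2(1-z)+2\sqrt{\lambda\mu_1/z}$, and let $z\in[\eta,\rho_2]$. Let $\mathbf{w}=(w_0,w_1,\dots)$ be defined by $w_0=1$, $\mu_1w_1=(\lambda+\mu_2(1-z))z$, and $$\mu_1w_{k+1}=(\lambda+\mu_1+\mu_2(1-z))z\,w_k-\lambda z\,w_{k-1},\qquad k\ge1,$$ and define $$\nu_1=\frac{(\lambda-\mu_2z)w_0}{w_1},\qquad \nu_{i+1}=\frac{(\nu_i+\lambda+\mu_1-\mu_2z)w_i-\lambda w_{i-1}}{w_{i+1}},\quad i\ge1.$$ Consider the tandem Jackson network with infinite waiting room at the first queue, modified by adding, when the second queue is empty and there are $i\ge1$ customers in the first queue, an extra transition at rate $\nu_i$ which removes one customer from the first queue without adding it to the second queue. Then the stationary distribution $\boldsymbol{\pi}=(\boldsymbol{\pi}_0,\boldsymbol{\pi}_1,\dots)$ of this modified process, where $\boldsymbol{\pi}_n=(\pi_{n0},\pi_{n1},\dots)$ collects the stationary probabilities of $n$ customers in queue 2 and $0,1,\dots$ customers in queue 1, is given by $$\boldsymbol{\pi}_n=c\,z^n\,\mathbf{w},\qquad n\ge0,$$ for some normalizing constant $c$. In particular the decay rate of the stationary distribution of the second queue is $z$.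
   Context: The modified process is the continuous-time Markov chain on $\{(k,j):k,j\ge0\}$ ($k$ customers in queue 2, $j$ in queue 1) with transitions: $(k,j)\to(k,j+1)$ at rate $\lambda$; $(k,j)\to(k+1,j-1)$ at rate $\mu_1$ for $j\ge1$; $(k,j)\to(k-1,j)$ at rate $\mu_2$ for $k\ge1$; and, in addition, $(0,i)\to(0,i-1)$ at rate $\nu_i$ for $i\ge1$. *)

(* Defs.v *)
From HB Require Import structures.
From mathcomp Require Import all_boot all_order all_algebra.
From mathcomp Require Import all_classical all_reals all_analysis.

Set Implicit Arguments.
Unset Strict Implicit.
Unset Printing Implicit Defensive.

Import Order.TTheory GRing.Theory Num.Theory.
Import numFieldNormedType.Exports.

Local Open Scope classical_set_scope.
Local Open Scope ring_scope.

(* [P] is the transition function, P t x y = Pr(X_t = y | X_0 = x), of an     *)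
(* honest continuous-time Markov chain on the countable set [S] which jumps   *)
(* from x to y != x at rate [q x y]; only the values P t with 0 <= t matter.  *)
(* All summands are nonnegative, so [esum] is the usual sum; the last field   *)
(* is a limit in \bar R, so an infinite total rate cannot go unnoticed.       *)
Record transition_function (R : realType) (S : countType)
    (q : S -> S -> R) (P : R -> S -> S -> R) : Prop := TransitionFunction {
  tf_ge0 : forall t x y, 0 <= t -> 0 <= P t x y ;
  tf_sum1 : forall t x, 0 <= t ->
    (\esum_(y in [set: S]) (P t x y)%:E = 1)%E ;
  tf_0 : forall x y, P 0 x y = (x == y)%:R ;
  tf_chapman_kolmogorov : forall s t x y, 0 <= s -> 0 <= t ->
    (\esum_(u in [set: S]) (P s x u * P t u y)%:E = (P (s + t) x y)%:E)%E ;
  tf_rate : forall x y, x != y -> P h x y / h @[h --> 0^'+] --> q x y ;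
  tf_exit_rate : forall x,
    (((1 - P h x x) / h)%:E @[h --> 0^'+] -->
       \esum_(y in [set y | y != x]) (q x y)%:E)%E
}.

Record stationary_distribution (R : realType) (S : countType)
    (P : R -> S -> S -> R) (pi : S -> R) : Prop := StationaryDistribution {
  sd_ge0 : forall x, 0 <= pi x ;
  sd_sum1 : (\esum_(x in [set: S]) (pi x)%:E = 1)%E ;
  sd_invariant : forall t y, 0 <= t ->
    (\esum_(x in [set: S]) (pi x * P t x y)%:E = (pi y)%:E)%E
}.

(* A state is (k, j): k customers in queue 2 and j customers in queue 1. The  *)
(* four targets differ from each other and from (k, j). [nu 0] is never used. *)
Definition modified_tandem_rate (R : realType) (lambda mu1 mu2 : R)
    (nu : nat -> R) (x y : nat * nat) : R :=
  let: (k, j) := x in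
  (if y == (k, j.+1) then lambda else 0)
  + (if (0 < j)%N && (y == (k.+1, j.-1)) then mu1 else 0)
  + (if (0 < k)%N && (y == (k.-1, j)) then mu2 else 0)
  + (if [&& k == 0%N, (0 < j)%N & y == (0%N, j.-1)] then nu j else 0).

Definition tau (R : realType) (lambda mu1 mu2 z : R) : R :=
  - lambda - mu1 - mu2 * (1 - z) + 2 * Num.sqrt (lambda * mu1 / z).

(* The marginal law of the second queue. *)
Definition queue2_distribution (R : realType) (pi : nat * nat -> R)
    (n : nat) : R :=
  fine (\esum_(x in [set x : nat * nat | x.1 = n]) (pi x)%:E)%E.

Definition has_decay_rate (R : realType) (p : nat -> R) (r : R) : Prop :=
  p n.+1 / p n @[n --> \oo] --> r.

(* Main.v *)
Require Import Defs.
From HB Require Import structures.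
From mathcomp Require Import all_boot all_order all_algebra.
From mathcomp Require Import all_classical all_reals all_analysis.
From mathcomp Require Import ring lra.

Set Implicit Arguments.
Unset Strict Implicit.
Unset Printing Implicit Defensive.

Import Order.TTheory GRing.Theory Num.Theory.
Import numFieldNormedType.Exports.

Local Open Scope classical_set_scope.
Local Open Scope ring_scope.

(** The modified chain has bounded rates, because the extra rates have the closed
    form nu i = mu1 / (z * (1 - z)) * (w 1 - w i.+1 / w i) (nu_closed). They are
    nonnegative since w is log-concave, which makes the ratios w i.+1 / w i
    nonincreasing (w_log_concave, w_submultiplicative). Positivity of w comes from
    the roots r1 <= r2 < 1 of its characteristic polynomial: they are real exactly
    when tau z <= 0, that is when z is not below eta, and they are at least z when
    z <= lambda / mu2, so that w 1 = r1 + r2 - z >= r1 (characteristic_roots,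
    w_growth). The same recurrence telescopes to a bound on the partial sums of w,
    and the sign of tau is that of a cubic in the square root of its argument
    (tau_cubic, tau_le0_of_zero).

    For a chain with bounded rates the transition function exists: it is the
    Poisson mixture of the powers of a jump kernel (bounded_rates_transition).
    For any transition function with these rates, known only through its
    derivatives at 0, the invariant probabilities are the solutions of the global
    balance equations (stationary_iff_balance). Indeed the exit rate times t
    bounds the probability of being elsewhere at any time t (tf_diag_ge), and by
    dominated convergence the flow over a short time h is at least its first order
    approximation up to an error e * h in total (rate_defect_small, flow_le).
    Losses of mass are subadditive in time (short_byD), so a balanced law loses
    nothing over any time; conversely, for an invariant law the inflow at each
    state is at most the outflow, and both have the same total.

    The balance equations of an irreducible chain have at most one probability
    solution: the minimum of two solutions is again one (balance_unique). It
    remains to check that z ^+ n * w j solves them, which is what the recurrences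
    for w and nu say (product_form_balance), and that its mass is finite. The
    marginal of the second queue is then exactly geometric of ratio z. *)

(** * Sums of nonnegative families *)

Section esum_complements.
Context {R : realType}.
Local Open Scope ereal_scope.
Implicit Types (T : choiceType).

Lemma esum_ge_term T (f : T -> \bar R) i :
  (forall j, 0 <= f j) -> f i <= \esum_(j in [set: T]) f j.
Proof.
move=> f0; apply: esum_ge; exists [set i]; last by rewrite fsbig_set1.
by split => //; exact: finite_set1.
Qed.

Lemma esum_eq0_term T (f : T -> \bar R) :
  (forall j, 0 <= f j) -> \esum_(j in [set: T]) f j = 0 -> forall i, f i = 0.
Proof.
move=> f0 sf i; apply/eqP; rewrite eq_le f0 andbT -sf.
exact: esum_ge_term.
Qed.

Lemma esumZl T (c : \bar R) (f : T -> \bar R) : 0 <= c ->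
  (forall i, 0 <= f i) ->
  \esum_(i in [set: T]) (c * f i) = c * \esum_(i in [set: T]) f i.
Proof.
have le1 (d : \bar R) (g : T -> \bar R) : 0 <= d -> (forall i, 0 <= g i) ->
    \esum_(i in [set: T]) (d * g i) <= d * \esum_(i in [set: T]) g i.
  move=> d0 g0; apply: ge_ereal_sup => /= _ [X [finX XI]] <-.
  rewrite -ge0_mule_fsumr//; apply: lee_wpmul2l => //.
  by apply: ereal_sup_ubound; exists X.
move=> c0 f0; apply/eqP; rewrite eq_le le1//=.
have cf0 i : 0 <= c * f i by exact: mule_ge0.
move: c c0 cf0 => [r r0 cf0|_ cf0|//]; last first.
  have [-> |] := eqVneq (\esum_(i in [set: T]) f i) 0.
    by rewrite mule0; exact: esum_ge0.
  move=> sf0; rewrite gt0_mulye ?lt0e ?sf0 ?esum_ge0//.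
  have [i fi] : exists i, f i != 0.
    apply: contrapT => /forallNP f00; move/negP: sf0; apply; apply/eqP.
    by apply: esum1 => i _; apply/eqP/negP => /negP; exact: f00.
  apply: le_trans (esum_ge_term i cf0).
  by rewrite gt0_mulye// lt0e fi f0.
have {r0} : (0 == r)%R || (0 < r)%R by rewrite -le_eqVlt -lee_fin.
move=> /predU1P[<-|r0].
  by rewrite mul0e; apply: esum_ge0 => i _; rewrite mul0e.
have -> : \esum_(i in [set: T]) f i =
    \esum_(i in [set: T]) (r^-1%:E * (r%:E * f i)).
  by apply: eq_esum => i _; rewrite muleA -EFinM mulVf ?mul1e// gt_eqF.
have := le1 r^-1%:E _ _ cf0; rewrite lee_fin invr_ge0 (ltW r0) => /(_ isT) le2.
apply: le_trans (lee_wpmul2l _ le2) _; first by rewrite lee_fin ltW.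
by rewrite muleA -EFinM mulfV ?mul1e// gt_eqF.
Qed.

Lemma esumZr T (c : \bar R) (f : T -> \bar R) : 0 <= c ->
  (forall i, 0 <= f i) ->
  \esum_(i in [set: T]) (f i * c) = (\esum_(i in [set: T]) f i) * c.
Proof.
by move=> c0 f0; rewrite muleC -esumZl//; apply: eq_esum => i _; rewrite muleC.
Qed.

Lemma exchange_esum (T1 T2 : choiceType) (a : T1 -> T2 -> \bar R) :
  (forall i j, 0 <= a i j) ->
  \esum_(i in [set: T1]) \esum_(j in [set: T2]) a i j =
  \esum_(j in [set: T2]) \esum_(i in [set: T1]) a i j.
Proof.
move=> a0; rewrite esum_esum// esum_esum//.
rewrite (reindex_esum ([set: T2] `*`` fun=> [set: T1]) _ (fun x => (x.2, x.1)))//.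
by split => //= [[i j] [i' j'] _ _ [-> ->]|[i j] _]//; exists (j, i).
Qed.

Lemma pair_esum (T1 T2 : choiceType) (a : T1 -> T2 -> \bar R) :
  (forall i j, 0 <= a i j) ->
  \esum_(i in [set: T1]) \esum_(j in [set: T2]) a i j =
  \esum_(k in [set: T1 * T2]) a k.1 k.2.
Proof.
move=> a0; rewrite esum_esum//; congr (esum _ _).
by apply/seteqP; split => // -[i j] _.
Qed.

Lemma esum_if T (p : T) (v : \bar R) : 0 <= v ->
  \esum_(x in [set: T]) (if x == p then v else 0) = v.
Proof.
move=> v0; rewrite -[RHS](@esum_set1 R T p (fun=> v))// [RHS]esum_mkcond.
apply: eq_esum => x _; suff -> : (x \in [set p]) = (x == p) by [].
by apply/idP/eqP; rewrite inE.
Qed.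

(** At most four transitions of the network lead out of, or into, a given state:
    the rows and the columns of its rates have this shape. *)
Lemma esum_if4 T (f : T -> R) (p1 p2 p3 p4 : T) (v1 v2 v3 v4 : R) :
  (0 <= v1 -> 0 <= v2 -> 0 <= v3 -> 0 <= v4 ->
  (forall x, f x = (if x == p1 then v1 else 0) + (if x == p2 then v2 else 0)
     + (if x == p3 then v3 else 0) + (if x == p4 then v4 else 0)) ->
  \esum_(x in [set: T]) (f x)%:E = (v1 + v2 + v3 + v4)%:E)%R.
Proof.
move=> v10 v20 v30 v40 fE.
pose g p v (x : T) : \bar R := if x == p then v%:E else 0.
have g0 p v x : (0 <= v)%R -> 0 <= g p v x by rewrite /g; case: ifP.
have -> : \esum_(x in [set: T]) (f x)%:E =
    \esum_(x in [set: T]) (g p1 v1 x + g p2 v2 x + g p3 v3 x + g p4 v4 x).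
  apply: eq_esum => x _; rewrite fE !EFinD /g.
  by do 4 case: ifP => _.
rewrite !esumD//; try by move=> x _; rewrite ?adde_ge0 ?g0.
by rewrite !esum_if.
Qed.

Lemma esum_antidiagonal (a : nat -> nat -> \bar R) :
  (forall i j, 0 <= a i j) ->
  \esum_(n in [set: nat]) \esum_(m in [set: nat]) a n m =
  \esum_(N in [set: nat]) \sum_(i < N.+1) a i (N - i)%N.
Proof.
move=> a0.
transitivity (\esum_(N in [set: nat]) \esum_(i in `I_N.+1) a i (N - i)%N).
  rewrite esum_esum// [RHS]esum_esum//.
  rewrite [RHS](reindex_esum ([set: nat] `*`` fun=> [set: nat]) _
    (fun x => (x.1 + x.2, x.1)%N))//=.
    by apply: eq_esum => -[n m] _ /=; rewrite addKn.
  split => /=.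
  - by move=> [n m] _ /=; split => //=; rewrite ltnS leq_addr.
  - move=> [n m] [n' m'] _ _ /= [+ nn']; rewrite nn' => /addnI ->; reflexivity.
  - move=> [N i] [_ /= iN]; exists (i, (N - i)%N) => //=.
    by rewrite subnKC.
apply: eq_esum => N _; have IN : finite_set `I_N.+1 by exact: finite_II.
rewrite esum_fset//.
by rewrite -(fsbig_ord _ _ (fun i => a i (N - i)%N)).
Qed.

(** The differences are nonnegative and, the sums being finite, add up to 0. *)
Lemma eq_esum_le T (f g : T -> \bar R) : (forall i, 0 <= f i) ->
  (forall i, f i <= g i) -> \esum_(i in [set: T]) g i < +oo ->
  \esum_(i in [set: T]) g i <= \esum_(i in [set: T]) f i ->
  forall i, f i = g i.
Proof.
move=> f0 fg goo gf.
have g0 i : 0 <= g i by exact: le_trans (f0 i) (fg i).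
have gfin i : g i \is a fin_num.
  by rewrite ge0_fin_numE//; apply: le_lt_trans goo; exact: esum_ge_term.
have ffin i : f i \is a fin_num.
  by rewrite ge0_fin_numE//; apply: le_lt_trans (fg i) _; rewrite -ge0_fin_numE.
have d0 i : 0 <= g i - f i by rewrite suber_ge0.
have sfin : \esum_(i in [set: T]) f i \is a fin_num.
  rewrite ge0_fin_numE ?esum_ge0//; apply: le_lt_trans goo.
  by apply: le_esum => i _; exact: fg.
have sd : \esum_(i in [set: T]) (g i - f i) = 0.
  apply/eqP; rewrite eq_le esum_ge0// andbT.
  have : \esum_(i in [set: T]) g i = \esum_(i in [set: T]) f i +
      \esum_(i in [set: T]) (g i - f i).
    rewrite -esumD//; apply: eq_esum => i _.
    by rewrite addeC subeK.
  by move=> sg; move: gf; rewrite sg -leeBrDl// subee.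
by move=> i; rewrite -[RHS](@subeK _ _ (f i))// (esum_eq0_term d0 sd) add0e.
Qed.

(** Dominated convergence for sums: outside a finite set of indices the
    dominating family contributes at most half of the bound, and on this finite
    set the terms tend to zero. *)
Lemma esum_dominated_near T (I : Type) (F : set_system I) {FF : Filter F}
    (a : T -> R) (b : I -> T -> R) (e : R) :
  (forall i, 0 <= a i)%R -> \esum_(i in [set: T]) (a i)%:E < +oo ->
  (\forall h \near F, forall i, (0 <= b h i <= a i)%R) ->
  (forall i, b h i @[h --> F] --> (0 : R)%R) -> (0 < e)%R ->
  \forall h \near F, \esum_(i in [set: T]) (b h i)%:E <= e%:E.
Proof.
move=> a0 aoo ba b0 e0.
have a0E i : 0 <= (a i)%:E by rewrite lee_fin.
have afin : \esum_(i in [set: T]) (a i)%:E \is a fin_num.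
  by rewrite ge0_fin_numE ?esum_ge0.
have e20 : (0 < e / 2)%R by rewrite divr_gt0.
have [_ [X [finX _] <-] Xa] := ub_ereal_sup_adherent e20 afin.
have tail : \esum_(i in ~` X) (a i)%:E <= (e / 2)%:E.
  move: Xa; rewrite -/(esum setT _) (esumID X)// !setTI esum_fset//.
  have Xfin : \sum_(i \in X) (a i)%:E \is a fin_num.
    by rewrite fsumEFin.
  rewrite -addeA -[ltRHS]adde0 lteD2lE// => /ltW.
  by rewrite leeBlDr// add0e.
have head : (\sum_(i <- finmap.enum_fset (fset_set X)) b h i)%R @[h --> F] --> (0 : R)%R.
  elim: (finmap.enum_fset _) => [|i s IHs].
    by under eq_fun do rewrite big_nil; exact: cvg_cst.
  under eq_fun do rewrite big_cons.
  by have := cvgD (b0 i) IHs; rewrite addr0; apply.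
have near_head := cvgr_lt _ head _ e20.
near=> h.
have bh : forall i, (0 <= b h i <= a i)%R by near: h.
rewrite (esumID X); last by move=> i _; rewrite lee_fin; have /andP[] := bh i.
rewrite !setTI esum_fset//; last first.
  by move=> i _; rewrite lee_fin; have /andP[] := bh i.
rewrite (splitr e) EFinD leeD//.
  rewrite fsumEFin// lee_fin fsbig_finite//= ltW//.
  by near: h; exact: near_head.
apply: le_trans tail; apply: le_esum => i _; rewrite lee_fin.
by have /andP[] := bh i.
Unshelve. all: by end_near.
Qed.

End esum_complements.

(** * Chains with bounded rates: short-time behavior *)

Definition exit_rate {R : realType} {S : countType} (q : S -> S -> R) (x : S) : R :=
  fine (\esum_(y in [set: S]) (q x y)%:E)%E.

Definition global_balance {R : realType} {S : countType} (q : S -> S -> R)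
    (pi : S -> R) : Prop :=
  forall y, (\esum_(x in [set: S]) (pi x * q x y)%:E = (pi y * exit_rate q y)%:E)%E.

Lemma near_right0_divide {R : realType} (A : set R) :
  (\forall h \near 0^'+, A h) -> forall t, 0 < t -> exists n, A (t / n.+1%:R).
Proof.
move=> [e /= e0 eA] t t0.
have [n tn] : exists n, t / e < n.+1%:R.
  have /archi_boundP : 0 <= t / e by rewrite divr_ge0 ?ltW.
  set n := Num.bound _ => tn; exists n; apply: lt_le_trans tn _.
  by rewrite ler_nat.
exists n; apply: eA; last by rewrite divr_gt0.
rewrite /= sub0r normrN gtr0_norm ?divr_gt0// ltr_pdivrMr//.
by rewrite mulrC -ltr_pdivrMr.
Qed.

Section bounded_rates.
Context {R : realType} {S : countType}.
Variables (q : S -> S -> R) (L : R).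
Hypotheses (L_gt0 : 0 < L) (q_ge0 : forall x y, 0 <= q x y) (q_diag : forall x, q x x = 0)
  (q_bounded : forall x, (\esum_(y in [set: S]) (q x y)%:E <= L%:E)%E).

Let q_geE x y : (0 <= (q x y)%:E)%E. Proof. by rewrite lee_fin. Qed.

Lemma exit_rateE x :
  (\esum_(y in [set: S]) (q x y)%:E = (exit_rate q x)%:E)%E.
Proof.
rewrite fineK// ge0_fin_numE ?esum_ge0//.
by apply: le_lt_trans (q_bounded x) _; exact: ltry.
Qed.

Lemma exit_rate_neqE x :
  (\esum_(y in [set y | y != x]) (q x y)%:E = (exit_rate q x)%:E)%E.
Proof.
rewrite -exit_rateE esum_mkcond; apply: eq_esum => y _.
case: ifPn => // /negP; rewrite inE /= => /negP; rewrite negbK => /eqP ->.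
by rewrite q_diag.
Qed.

Lemma exit_rate_ge0 x : 0 <= exit_rate q x.
Proof. by rewrite -lee_fin -exit_rateE esum_ge0. Qed.

Lemma exit_rate_le x : exit_rate q x <= L.
Proof. by rewrite -lee_fin -exit_rateE. Qed.

Lemma total_flowE (pi : S -> R) : (forall x, 0 <= pi x) ->
  (\esum_(y in [set: S]) \esum_(x in [set: S]) (pi x * q x y)%:E =
   \esum_(x in [set: S]) (pi x * exit_rate q x)%:E)%E.
Proof.
move=> pi0; rewrite exchange_esum; last by move=> *; rewrite lee_fin mulr_ge0.
apply: eq_esum => x _; under eq_esum do rewrite EFinM.
by rewrite esumZl ?lee_fin// exit_rateE -EFinM.
Qed.

Lemma total_flow_fin (pi : S -> R) : (forall x, 0 <= pi x) ->
  (\esum_(x in [set: S]) (pi x)%:E < +oo)%E ->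
  (\esum_(x in [set: S]) (pi x * exit_rate q x)%:E < +oo)%E.
Proof.
move=> pi0 pioo.
apply: (@le_lt_trans _ _ (\esum_(x in [set: S]) ((pi x)%:E * L%:E))%E).
  apply: le_esum => x _; rewrite -EFinM lee_fin.
  by rewrite ler_wpM2l// exit_rate_le.
have pi0E x : (0 <= (pi x)%:E)%E by rewrite lee_fin.
rewrite esumZr//; last by rewrite lee_fin ltW.
by rewrite lte_mul_pinfty ?lee_fin ?ltry ?ge0_fin_numE ?esum_ge0//; exact: ltW.
Qed.

Section transition.
Variable (P : R -> S -> S -> R).
Hypothesis tfP : transition_function q P.

Lemma tf_le1 t x y : 0 <= t -> P t x y <= 1.
Proof.
move=> t0; rewrite -lee_fin -(tf_sum1 tfP x t0).
apply: (@esum_ge_term _ _ (fun y => (P t x y)%:E)) => j.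
by rewrite lee_fin; exact: tf_ge0 tfP _ _ _ t0.
Qed.

Lemma tf_diagD s t x : 0 <= s -> 0 <= t ->
  1 - P (s + t) x x <= (1 - P s x x) + (1 - P t x x).
Proof.
move=> s0 t0.
have PP : P s x x * P t x x <= P (s + t) x x.
  rewrite -lee_fin -(tf_chapman_kolmogorov tfP x x s0 t0).
  apply: (@esum_ge_term _ _ (fun u => (P s x u * P t u x)%:E)) => j.
  by rewrite lee_fin mulr_ge0// (tf_ge0 tfP).
have := tf_le1 x x s0; have := tf_le1 x x t0.
have := tf_ge0 tfP x x s0; have := tf_ge0 tfP x x t0.
nra.
Qed.

Lemma tf_exit_rateR x : (1 - P h x x) / h @[h --> 0^'+] --> exit_rate q x.
Proof.
have := @tf_exit_rate _ _ _ _ tfP x.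
rewrite exit_rate_neqE.
by move/fine_cvgP => -[].
Qed.

(** The function 1 - P t x x is subadditive in t, so it is at most t times its
    slope at 0, which is the exit rate. *)
Lemma tf_diag_ge t x : 0 < t -> 1 - P t x x <= t * exit_rate q x.
Proof.
move=> t0; apply/ler_addgt0Pr => e e0.
have et0 : 0 < e / t by rewrite divr_gt0.
have xe : exit_rate q x < exit_rate q x + e / t by rewrite ltrDl.
have [n /=] := near_right0_divide (cvgr_lt _ (tf_exit_rateR (x := x)) _ xe) t0.
(* The time t is cut into n.+1 steps that are short enough for the limit. *)
set h := t / n.+1%:R => hle.
have h0 : 0 < h by rewrite divr_gt0.
have mul k : 1 - P (k%:R * h) x x <= k%:R * (1 - P h x x).
  elim: k => [|k IHk]; first by rewrite !mul0r (tf_0 tfP) eqxx subrr.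
  rewrite -natr1 !mulrDl !mul1r.
  have kh0 : 0 <= k%:R * h by rewrite mulr_ge0// ltW.
  by apply: le_trans (tf_diagD _ kh0 (ltW h0)) _; rewrite lerD2r.
have := mul n.+1; rewrite /h mulrC divfK ?pnatr_eq0// -/h => /le_trans; apply.
have -> : t * exit_rate q x + e = n.+1%:R * (h * (exit_rate q x + e / t)).
  by rewrite mulrA /h [n.+1%:R * _]mulrC divfK ?pnatr_eq0// mulrDr mulrCA mulfV ?mulr1// gt_eqF.
by rewrite ler_pM2l// mulrC -ler_pdivrMr// ltW.
Qed.

(** The part of the rate that is not realized over time h. It is truncated at 0
    because only a deficit of flow has to be controlled. *)
Definition rate_defect h x y : R := Num.max 0 (q x y - P h x y / h).

Lemma rate_defect_ge0 h x y : 0 <= rate_defect h x y.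
Proof. by rewrite /rate_defect le_max lexx. Qed.

(** For small times the probability flow falls short of its first order
    approximation by an arbitrarily small fraction of the time: the defect of
    the rates is dominated by the rates themselves, whose total is finite. *)
Lemma rate_defect_small (pi : S -> R) (e : R) : (forall x, 0 <= pi x) ->
  (\esum_(x in [set: S]) (pi x)%:E < +oo)%E -> 0 < e ->
  \forall h \near 0^'+,
    (\esum_(y in [set: S]) \esum_(x in [set: S])
       (pi x * rate_defect h x y)%:E <= e%:E)%E.
Proof.
move=> pi0 pioo e0.
pose a (k : S * S) := pi k.1 * q k.1 k.2.
pose b h (k : S * S) := pi k.1 * rate_defect h k.1 k.2.
have a0 k : 0 <= a k by rewrite mulr_ge0.
have : \forall h \near 0^'+, (\esum_(k in [set: S * S]) (b h k)%:E <= e%:E)%E.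
  apply: (@esum_dominated_near _ _ _ _ _ a) => //.
  - rewrite -(pair_esum (a := fun x y => (pi x * q x y)%:E)) => [|x y]; last first.
      by rewrite lee_fin mulr_ge0.
    rewrite exchange_esum => [|x y]; last by rewrite lee_fin mulr_ge0.
    by rewrite total_flowE// total_flow_fin.
  - near=> h => k; rewrite mulr_ge0 ?rate_defect_ge0//=.
    rewrite /b /a ler_wpM2l// /rate_defect ge_max q_ge0/=.
    have h0 : 0 < h by near: h; exact: nbhs_right_gt.
    by rewrite gerBl divr_ge0 ?(tf_ge0 tfP) ?ltW.
  - move=> [x y]; rewrite /b /=.
    rewrite -[X in _ --> X](mulr0 (pi x)); apply: cvgMr.
    have [<-{y}|xy] := eqVneq x y.
      apply: cvg_near_cst; near=> h; rewrite /rate_defect q_diag sub0r.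
      have h0 : 0 < h by near: h; exact: nbhs_right_gt.
      by apply/max_idPl; rewrite oppr_le0 divr_ge0 ?(tf_ge0 tfP) ?ltW.
    have dq : `|q x y - P h x y / h| @[h --> 0^'+] --> (0 : R).
      have := cvg_norm (cvgB (cvg_cst (q x y)) (tf_rate tfP xy)).
      by rewrite subrr normr0; apply.
    apply: squeeze_cvgr dq; last exact: (@cvg_cst _ (0 : R)).
    by near=> h; rewrite rate_defect_ge0/= /rate_defect ge_max normr_ge0 ler_norm.
apply: filterS => h; apply: le_trans; rewrite exchange_esum => [|x y]; last first.
  by rewrite lee_fin mulr_ge0// rate_defect_ge0.
rewrite (pair_esum (a := fun x y => (pi x * rate_defect h x y)%:E))//.
by move=> *; rewrite lee_fin mulr_ge0// rate_defect_ge0.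
Unshelve. all: by end_near.
Qed.

End transition.
End bounded_rates.

(** * Stationary laws and global balance *)

Section stationarity.
Context {R : realType} {S : countType}.
Variables (q : S -> S -> R) (L : R).
Hypotheses (L_gt0 : 0 < L) (q_ge0 : forall x y, 0 <= q x y)
  (q_diag : forall x, q x x = 0)
  (q_bounded : forall x, (\esum_(y in [set: S]) (q x y)%:E <= L%:E)%E).
Variable (P : R -> S -> S -> R).
Hypothesis tfP : transition_function q P.
Variable pi : S -> R.
Hypotheses (pi_ge0 : forall x, 0 <= pi x)
  (pi_sum1 : (\esum_(x in [set: S]) (pi x)%:E = 1)%E).

Let pi_fin : (\esum_(x in [set: S]) (pi x)%:E < +oo)%E.
Proof. by rewrite pi_sum1 ltry. Qed.

Let P_ge0 t x y : 0 <= t -> 0 <= P t x y. Proof. by move=> t0; exact: (tf_ge0 tfP). Qed.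

Let piP_ge0 t x y : 0 <= t -> (0 <= (pi x * P t x y)%:E)%E.
Proof. by move=> t0; rewrite lee_fin mulr_ge0// P_ge0. Qed.

Let piq_ge0 x y : (0 <= (pi x * q x y)%:E)%E.
Proof. by rewrite lee_fin mulr_ge0. Qed.

Let pid_ge0 h x y : (0 <= (pi x * rate_defect q P h x y)%:E)%E.
Proof. by rewrite lee_fin mulr_ge0// rate_defect_ge0. Qed.

(** Mass comes into y from each x != y with probability at least h * q x y, up to
    the defect, and by tf_diag_ge what was in y stays there except for at most
    h * exit_rate q y of it. *)
Lemma flow_le h y : 0 < h ->
  (h%:E * (\esum_(x in [set: S]) (pi x * q x y)%:E) + (pi y)%:E <=
   \esum_(x in [set: S]) (pi x * P h x y)%:E +
   h%:E * (\esum_(x in [set: S]) (pi x * rate_defect q P h x y)%:E) +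
   (h * (pi y * exit_rate q y))%:E)%E.
Proof.
move=> h0; have h0E : (0 <= h%:E)%E by rewrite lee_fin ltW.
rewrite -!esumZl//.
rewrite -esumD//; last 2 first.
- by move=> x _; exact: piP_ge0 (ltW h0).
- by move=> x _; rewrite mule_ge0.
have stay : pi y <= pi y * P h y y + h * (pi y * exit_rate q y).
  have := tf_diag_ge q_ge0 q_diag q_bounded tfP y h0.
  move: (pi_ge0 y) (exit_rate q y) => py0 r; nra.
apply: (@le_trans _ _ (\esum_(x in [set: S]) (h%:E * (pi x * q x y)%:E) +
    ((pi y * P h y y)%:E + (h * (pi y * exit_rate q y))%:E))%E).
  by rewrite leeD2l// -EFinD lee_fin.
rewrite addeA leeD2r//.
rewrite -[X in (_ + X <= _)%E](esum_if y) ?piP_ge0 ?(ltW h0)//.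
rewrite -esumD//; last 2 first.
- by move=> x _; rewrite mule_ge0.
- by move=> x _; case: ifP => // _; exact: piP_ge0 (ltW h0).
apply: le_esum => x _; rewrite -!EFinM.
have := P_ge0 x y (ltW h0); rewrite /rate_defect.
have [->|xy] := eqVneq x y.
  rewrite q_diag !mulr0 add0e sub0r => P0; rewrite -EFinD lee_fin.
  by rewrite lerDl mulr_ge0 ?(ltW h0)// mulr_ge0// le_max lexx.
move=> P0; rewrite adde0 -EFinD lee_fin mulrCA [h * (_ * Num.max _ _)]mulrCA -mulrDr.
apply: ler_wpM2l => //.
have -> : h * q x y = P h x y + h * (q x y - P h x y / h).
  by rewrite mulrBr mulrCA mulfV ?gt_eqF// mulr1 addrC subrK.
by rewrite lerD2l ler_pM2l// le_max lexx orbT.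
Qed.

(** Over time t the law pi loses at most the mass m. The losses are bounded by a
    family e instead of being written as positive parts, which avoids
    subtractions of extended reals. *)
Definition short_by (t m : R) : Prop := exists e : S -> \bar R,
  [/\ forall y, (0 <= e y)%E, (\esum_(y in [set: S]) e y <= m%:E)%E &
      forall y, ((pi y)%:E <= \esum_(x in [set: S]) (pi x * P t x y)%:E + e y)%E].

Lemma short_byD s t m n : 0 <= s -> 0 <= t ->
  short_by s m -> short_by t n -> short_by (s + t) (m + n).
Proof.
move=> s0 t0 [e [e0 em es]] [f [f0 fn ft]].
have PE0 u y : (0 <= (P t u y)%:E)%E by rewrite lee_fin P_ge0.
exists (fun y => \esum_(u in [set: S]) (e u * (P t u y)%:E) + f y)%E; split.
- by move=> y; rewrite adde_ge0// esum_ge0// => u _; exact: mule_ge0.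
- rewrite esumD// => [|y _]; last first.
    by apply: esum_ge0 => u _; exact: mule_ge0.
  rewrite EFinD leeD//; apply: le_trans em.
  rewrite exchange_esum => [|y u]; last exact: mule_ge0.
  apply: le_esum => u _; rewrite esumZl//.
  by rewrite (tf_sum1 tfP)// mule1.
- move=> y; apply: le_trans (ft y) _; rewrite addeA leeD2r//.
  have -> : (\esum_(x in [set: S]) (pi x * P (s + t) x y)%:E =
      \esum_(u in [set: S])
        ((\esum_(x in [set: S]) (pi x * P s x u)%:E) * (P t u y)%:E))%E.
    transitivity (\esum_(u in [set: S]) \esum_(x in [set: S])
        ((pi x * P s x u)%:E * (P t u y)%:E))%E.
      rewrite exchange_esum => [|u x]; last first.
        by rewrite mule_ge0// piP_ge0.
      apply: eq_esum => x _; rewrite EFinM -(tf_chapman_kolmogorov tfP)//.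
      rewrite -esumZl ?lee_fin//; last first.
        by move=> u; rewrite lee_fin mulr_ge0// P_ge0.
      by apply: eq_esum => u _; rewrite -!EFinM mulrA.
    apply: eq_esum => u _; rewrite esumZr// => x; exact: piP_ge0.
  rewrite -esumD; last 2 first.
  - move=> u _; rewrite mule_ge0// esum_ge0// => x _; exact: piP_ge0.
  - by move=> u _; exact: mule_ge0.
  apply: le_esum => u _; rewrite EFinM -ge0_muleDl//; last first.
    by rewrite esum_ge0// => x _; exact: piP_ge0.
  by apply: lee_wpmul2r.
Qed.

(** Over a short time h a balanced law loses at most an arbitrarily small
    fraction of h at the states where it decreases; these losses add up over
    consecutive times, so none occurs over a time t cut into short pieces.
    Without losses there are no gains, since the total mass is preserved. *)
Lemma balance_invariant t y : global_balance q pi -> 0 <= t ->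
  (\esum_(x in [set: S]) (pi x * P t x y)%:E = (pi y)%:E)%E.
Proof.
move=> bal; rewrite le_eqVlt => /predU1P[<-|t0].
  transitivity (\esum_(x in [set: S]) (if x == y then (pi y)%:E else 0))%E.
    apply: eq_esum => x _; rewrite (tf_0 tfP).
    by case: eqVneq => [->|_]; rewrite ?mulr1 ?mulr0.
  by rewrite esum_if// lee_fin.
have short e : 0 < e -> short_by t e.
  move=> e0; have et0 : 0 < e / t by rewrite divr_gt0.
  have := rate_defect_small L_gt0 q_ge0 q_diag q_bounded tfP pi_ge0 pi_fin et0.
  move=> /near_right0_divide /(_ _ t0)[n].
  set h := t / n.+1%:R => hle.
  have h0 : 0 < h by rewrite divr_gt0.
  have h0E : (0 <= h%:E)%E by rewrite lee_fin ltW.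
  have base : short_by h (h * (e / t)).
    exists (fun y => h%:E *
      \esum_(x in [set: S]) (pi x * rate_defect q P h x y)%:E)%E; split.
    - by move=> x; rewrite mule_ge0// esum_ge0.
    - rewrite esumZl// => [|x]; last by rewrite esum_ge0.
      by rewrite [leRHS]EFinM; exact: lee_wpmul2l.
    - move=> x; have := flow_le x h0.
      by rewrite bal -EFinM [leRHS]addeC leeD2lE.
  have mul k : short_by (k.+1%:R * h) (k.+1%:R * (h * (e / t))).
    elim: k => [|k IHk]; first by rewrite !mul1r.
    rewrite -[k.+2%:R]natr1 mulrDl mul1r [X in short_by _ X]mulrDl mul1r.
    by apply: short_byD => //; rewrite ?mulr_ge0 ?ler0n// ltW.
  have := mul n; rewrite [X in short_by _ X]mulrA.
  rewrite /h [n.+1%:R * _]mulrC divfK ?pnatr_eq0//.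
  by rewrite [t * (e / t)]mulrC divfK ?gt_eqF.
apply/esym; move: y.
apply: (eq_esum_le (f := fun y => (pi y)%:E)
  (g := fun y => (\esum_(x in [set: S]) (pi x * P t x y)%:E)%E)).
- by move=> y; rewrite lee_fin.
- move=> y; apply/lee_addgt0Pr => e /short[f [f0 fe]] /(_ y)/le_trans; apply.
  rewrite leeD2l//; apply: le_trans fe; exact: esum_ge_term.
all: rewrite exchange_esum; last by move=> *; exact: piP_ge0 (ltW t0).
all: have -> : (\esum_(j in [set: S]) \esum_(i in [set: S]) (pi j * P t j i)%:E
  = 1)%E; rewrite ?pi_sum1 ?ltry//.
all: rewrite -pi_sum1; apply: eq_esum => x _; under eq_esum do rewrite EFinM.
all: rewrite esumZl ?lee_fin// => [|y]; rewrite ?lee_fin ?P_ge0 ?(ltW t0)//.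
all: by rewrite (tf_sum1 tfP) ?(ltW t0)// mule1.
Qed.

(** Invariance over short times shows that no state receives more flow than it
    emits; as both flows have the same finite total, they agree. *)
Lemma invariant_balance :
  (forall t y, 0 <= t ->
    (\esum_(x in [set: S]) (pi x * P t x y)%:E = (pi y)%:E)%E) ->
  global_balance q pi.
Proof.
move=> inv; rewrite /global_balance.
apply: (eq_esum_le (f := fun y => (\esum_(x in [set: S]) (pi x * q x y)%:E)%E)
  (g := fun y => (pi y * exit_rate q y)%:E)).
- by move=> y; exact: esum_ge0.
- move=> y; apply/lee_addgt0Pr => e e0.
  have := rate_defect_small L_gt0 q_ge0 q_diag q_bounded tfP pi_ge0 pi_fin e0.
  move=> /near_right0_divide /(_ _ ltr01)[n]; set h := 1 / _ => hle.
  have h0 : 0 < h by rewrite divr_gt0.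
  have h0E : (0 <= h%:E)%E by rewrite lee_fin ltW.
  have : (\esum_(x in [set: S]) (pi x * rate_defect q P h x y)%:E <= e%:E)%E.
    apply: le_trans hle; apply: (esum_ge_term (f := fun y => (\esum_(x in [set: S])
       (pi x * rate_defect q P h x y)%:E)%E)) => j; exact: esum_ge0.
  move=> /(lee_wpmul2l h0E) de.
  have flow : (h%:E * (\esum_(x in [set: S]) (pi x * q x y)%:E) + (pi y)%:E <=
      (pi y)%:E + h%:E * e%:E + (h * (pi y * exit_rate q y))%:E)%E.
    apply: le_trans (flow_le y h0) _; rewrite inv ?(ltW h0)//.
    by rewrite leeD2r// leeD2l.
  have shape : ((pi y)%:E + h%:E * e%:E + (h * (pi y * exit_rate q y))%:E =
      h%:E * (pi y * exit_rate q y + e)%:E + (pi y)%:E)%E.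
    by rewrite -!EFinM -!EFinD; congr EFin; ring.
  by move: flow; rewrite shape leeD2rE// lee_pmul2l// lte_fin.
- exact: (total_flow_fin L_gt0 q_ge0 q_bounded).
- by rewrite (total_flowE q_ge0 q_bounded).
Qed.

Lemma stationary_iff_balance :
  stationary_distribution P pi <-> global_balance q pi.
Proof.
split; first by case=> _ _; exact: invariant_balance.
by move=> bal; split => // t y; exact: balance_invariant.
Qed.

End stationarity.

Section uniqueness.
Context {R : realType} {S : countType}.
Variables (q : S -> S -> R) (L : R).
Hypotheses (L_gt0 : 0 < L) (q_ge0 : forall x y, 0 <= q x y)
  (q_bounded : forall x, (\esum_(y in [set: S]) (q x y)%:E <= L%:E)%E).
(** Irreducibility, in terms of the sets that are closed under predecessors. *)
Hypothesis q_irreducible : forall Z : set S,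
  (forall x y, Z y -> 0 < q x y -> Z x) -> forall x y, Z x -> Z y.

Lemma balance_eq0 (d : S -> R) : (forall x, 0 <= d x) -> global_balance q d ->
  forall x, d x = 0 -> forall y, d y = 0.
Proof.
move=> d0 bal x dx y.
apply: (q_irreducible (Z := fun x => d x = 0)) dx => {}x {}y /= dy qxy.
have dq0 u : (0 <= (d u * q u y)%:E)%E by rewrite lee_fin mulr_ge0.
have := bal y; rewrite dy mul0r => /(esum_eq0_term dq0)/(_ x)[] /eqP.
by rewrite mulf_eq0 (gt_eqF qxy) orbF => /eqP.
Qed.

(** The minimum of two balanced laws receives at most the flow that it emits,
    hence is balanced, and so are the differences with it. At a given state one
    of these differences vanishes, thus it vanishes everywhere and the two laws
    are ordered. *)
Lemma balance_unique (p p' : S -> R) :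
  (forall x, 0 <= p x) -> (forall x, 0 <= p' x) ->
  (\esum_(x in [set: S]) (p x)%:E = 1)%E ->
  (\esum_(x in [set: S]) (p' x)%:E = 1)%E ->
  global_balance q p -> global_balance q p' -> p = p'.
Proof.
move=> p0 p'0 p1 p'1 bal bal'.
pose m x := Num.min (p x) (p' x).
have m0 x : 0 <= m x by rewrite le_min p0 p'0.
have mp x : m x <= p x by rewrite ge_min lexx.
have mp' x : m x <= p' x by rewrite ge_min lexx orbT.
have mfin : (\esum_(x in [set: S]) (m x)%:E < +oo)%E.
  apply: (@le_lt_trans _ _ (\esum_(x in [set: S]) (p x)%:E)%E).
    by apply: le_esum => x _; rewrite lee_fin.
  by rewrite p1 ltry.
have balm : global_balance q m.
  rewrite /global_balance.
  apply: (eq_esum_le (f := fun y => (\esum_(x in [set: S]) (m x * q x y)%:E)%E)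
    (g := fun y => (m y * exit_rate q y)%:E)).
  - by move=> y; apply: esum_ge0 => x _; rewrite lee_fin mulr_ge0.
  - move=> y; rewrite {2}/m minr_pMl ?(exit_rate_ge0 q_ge0 q_bounded)//.
    rewrite EFin_min le_min -bal -bal'.
    by apply/andP; split; apply: le_esum => x _; rewrite lee_fin ler_wpM2r.
  - exact: (total_flow_fin L_gt0 q_ge0 q_bounded).
  - by rewrite (total_flowE q_ge0 q_bounded).
have diff (r : S -> R) : (forall x, m x <= r x) -> global_balance q r ->
    global_balance q (fun x => r x - m x).
  move=> mr balr y; have := balr y.
  have -> : (\esum_(x in [set: S]) (r x * q x y)%:E =
      (m y * exit_rate q y)%:E +
      \esum_(x in [set: S]) ((r x - m x) * q x y)%:E)%E.
    rewrite -balm -esumD => [|x _|x _]; rewrite ?lee_fin ?mulr_ge0 ?subr_ge0//.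
    by apply: eq_esum => x _; rewrite -EFinD -mulrDl subrKC.
  have dfin : (m y * exit_rate q y)%:E \is a fin_num by [].
  by rewrite mulrBl EFinB => <-; rewrite [X in (X - _)%E]addeC addeK.
have ordered (r r' : S -> R) : (forall x, m x = r x) -> (forall x, m x <= r' x) ->
    (\esum_(x in [set: S]) (r x)%:E = 1)%E ->
    (\esum_(x in [set: S]) (r' x)%:E = 1)%E -> r = r'.
  move=> mr mr' r1 r'1; apply/funext => x.
  apply/EFin_inj; move: x.
  apply: eq_esum_le => [x|x||]; rewrite ?r1 ?r'1 ?lee_fin -?mr ?ltry//.
apply/funext => x; move: (x) => y.
have [px|p'x] := leP (p x) (p' x).
  rewrite (ordered p p')// => {}y; apply/esym/eqP; rewrite -subr_eq0; apply/eqP.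
  apply: (balance_eq0 _ (diff p mp bal) (x := x)) => [u|].
    by rewrite subr_ge0.
  by rewrite /m (min_idPl px) subrr.
rewrite (ordered p' p)// => {}y; apply/esym/eqP; rewrite -subr_eq0; apply/eqP.
apply: (balance_eq0 _ (diff p' mp' bal') (x := x)) => [u|].
  by rewrite subr_ge0.
by rewrite /m (min_idPr (ltW p'x)) subrr.
Qed.

End uniqueness.

(** * Existence of the transition function *)

Section poisson_weights.
Context {R : realType}.
Implicit Types (s t : R).

(** For t = 0 it is the Dirac mass at 0, whereas poisson_pmf is then constant. *)
Definition poisson_weight t n : R := expR (- t) * (t ^+ n / n`!%:R).

Lemma poisson_weight_ge0 t n : 0 <= t -> 0 <= poisson_weight t n.
Proof. by move=> t0; rewrite mulr_ge0 ?expR_ge0// divr_ge0// exprn_ge0. Qed.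

Lemma poisson_weight0 n : poisson_weight 0 n = (n == 0%N)%:R.
Proof.
rewrite /poisson_weight oppr0 expR0 mul1r; case: n => [|n].
  by rewrite expr0 fact0 divr1.
by rewrite expr0n mul0r.
Qed.

Lemma poisson_weight_sum1 t : 0 <= t ->
  (\esum_(n in [set: nat]) (poisson_weight t n)%:E = 1)%E.
Proof.
rewrite le_eqVlt => /predU1P[<-|t0].
  rewrite -[RHS](@esum_if R nat 0%N 1%E)//; apply: eq_esum => n _.
  by rewrite poisson_weight0; case: eqP.
have := @probability_setT _ _ _ (poisson_prob t 0%N).
rewrite /= /poisson_prob t0 => <-; apply: eq_esum => n _.
by rewrite /poisson_weight /poisson_pmf t0 mulrC.
Qed.

Lemma poisson_weight_convolution s t N :
  \sum_(i < N.+1) poisson_weight s i * poisson_weight t (N - i) =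
  poisson_weight (s + t) N.
Proof.
rewrite /poisson_weight opprD expRD addrC exprDn mulr_suml mulr_sumr.
apply: eq_bigr => i _.
have iN : (i <= N)%N by rewrite -ltnS ltn_ord.
have := bin_fact iN => /(congr1 (fun k => k%:R : R)); rewrite !natrM => bf.
have f0 k : k`!%:R != 0 :> R by rewrite pnatr_eq0 -lt0n fact_gt0.
rewrite -mulr_natl -bf.
have b0 : 'C(N, i)%:R != 0 :> R by rewrite pnatr_eq0 -lt0n bin_gt0.
by field; rewrite b0 !f0.
Qed.

End poisson_weights.

Section uniformization.
Context {R : realType} {S : countType}.
Variable K : S -> S -> R.
Hypotheses (K_ge0 : forall x y, 0 <= K x y)
  (K_sum1 : forall x, (\esum_(y in [set: S]) (K x y)%:E = 1)%E).
Local Open Scope ereal_scope.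

Fixpoint kernel_power n x y : \bar R :=
  if n is m.+1 then \esum_(u in [set: S]) (K x u)%:E * kernel_power m u y
  else ((x == y)%:R)%:E.

Let K_geE x y : 0 <= (K x y)%:E. Proof. by rewrite lee_fin. Qed.

Lemma kernel_power_ge0 n x y : 0 <= kernel_power n x y.
Proof.
by elim: n x => [|n IHn] x /=; [rewrite lee_fin|apply: esum_ge0 => u _; exact: mule_ge0].
Qed.

Lemma esum_deltal (f : S -> \bar R) x : (forall y, 0 <= f y) ->
  \esum_(u in [set: S]) ((x == u)%:R)%:E * f u = f x.
Proof.
move=> f0; rewrite -[RHS](esum_if x)//; apply: eq_esum => u _.
by rewrite [u == x]eq_sym; case: eqVneq => [->|]; rewrite ?mul1e ?mul0e.
Qed.

Lemma kernel_power1 x y : kernel_power 1 x y = (K x y)%:E.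
Proof.
rewrite /= -[RHS](esum_if y)//; apply: eq_esum => u _.
by case: eqVneq => [->|]; rewrite ?mule1 ?mule0.
Qed.

Lemma kernel_power_sum1 n x : \esum_(y in [set: S]) kernel_power n x y = 1.
Proof.
elim: n x => [|n IHn] x /=.
  rewrite -[RHS](@esum_deltal (fun=> 1) x)//.
  by apply: eq_esum => u _; rewrite mule1.
rewrite exchange_esum => [|y u]; last by rewrite mule_ge0// kernel_power_ge0.
rewrite -(K_sum1 x); apply: eq_esum => u _.
by rewrite esumZl// ?IHn ?mule1// => y; exact: kernel_power_ge0.
Qed.

Lemma kernel_power_le1 n x y : kernel_power n x y <= 1.
Proof.
rewrite -(kernel_power_sum1 n x); apply: esum_ge_term => u.
exact: kernel_power_ge0.
Qed.

Lemma kernel_powerD n m x y :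
  kernel_power (n + m) x y =
  \esum_(u in [set: S]) kernel_power n x u * kernel_power m u y.
Proof.
elim: n x => [|n IHn] x; first by rewrite /= esum_deltal// => u; exact: kernel_power_ge0.
rewrite addSn /=.
transitivity (\esum_(v in [set: S]) \esum_(u in [set: S])
    ((K x v)%:E * kernel_power n v u * kernel_power m u y)).
  apply: eq_esum => v _; rewrite IHn -esumZl// => [|u]; last first.
    by rewrite mule_ge0// kernel_power_ge0.
  by apply: eq_esum => u _; rewrite muleA.
rewrite exchange_esum => [|v u]; last by rewrite !mule_ge0// kernel_power_ge0.
apply: eq_esum => u _; rewrite esumZr ?kernel_power_ge0// => v.
by rewrite mule_ge0// kernel_power_ge0.
Qed.

(** The law at time t of the chain with jump kernel K subordinated to a Poisson
    process of unit intensity, that is exp (t (K - 1)). *)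
Definition poissonized t x y : \bar R :=
  \esum_(n in [set: nat]) (poisson_weight t n)%:E * kernel_power n x y.

Let term_ge0 t n x y : (0 <= t)%R ->
  0 <= (poisson_weight t n)%:E * kernel_power n x y.
Proof.
by move=> t0; rewrite mule_ge0 ?kernel_power_ge0// lee_fin poisson_weight_ge0.
Qed.

Lemma poissonized_ge0 t x y : (0 <= t)%R -> 0 <= poissonized t x y.
Proof. by move=> t0; apply: esum_ge0 => n _; exact: term_ge0. Qed.

Lemma poissonized0 x y : poissonized 0 x y = ((x == y)%:R)%:E.
Proof.
transitivity (\esum_(n in [set: nat])
    if n == 0%N then ((x == y)%:R)%:E else 0 : \bar R).
  apply: eq_esum => n _; rewrite poisson_weight0.
  by case: n => [|n]; rewrite ?mul1e ?mul0e.
by rewrite esum_if// lee_fin.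
Qed.

Lemma poissonized_sum1 t x : (0 <= t)%R ->
  \esum_(y in [set: S]) poissonized t x y = 1.
Proof.
move=> t0; rewrite exchange_esum => [|y n]; last exact: term_ge0.
rewrite -(poisson_weight_sum1 t0); apply: eq_esum => n _.
rewrite esumZl ?lee_fin ?poisson_weight_ge0// => [|y].
  by rewrite kernel_power_sum1 mule1.
exact: kernel_power_ge0.
Qed.

Lemma poissonized_fin t x y : (0 <= t)%R -> poissonized t x y \is a fin_num.
Proof.
move=> t0; rewrite ge0_fin_numE ?poissonized_ge0//.
apply: (@le_lt_trans _ _ 1); last by rewrite ltry.
rewrite -(poissonized_sum1 x t0); apply: esum_ge_term => u.
exact: poissonized_ge0.
Qed.

Lemma poissonizedD s t x y : (0 <= s)%R -> (0 <= t)%R ->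
  \esum_(u in [set: S]) (poissonized s x u * poissonized t u y) =
  poissonized (s + t) x y.
Proof.
move=> s0 t0.
pose a n m u := (poisson_weight s n)%:E * kernel_power n x u *
  ((poisson_weight t m)%:E * kernel_power m u y).
have a0 n m u : 0 <= a n m u by rewrite mule_ge0// term_ge0.
transitivity (\esum_(u in [set: S]) \esum_(n in [set: nat])
    \esum_(m in [set: nat]) a n m u).
  apply: eq_esum => u _; rewrite -esumZr ?poissonized_ge0//; last first.
    by move=> n; exact: term_ge0.
  apply: eq_esum => n _; rewrite esumZl ?term_ge0// => m; exact: term_ge0.
rewrite exchange_esum => [|u n]; last exact: esum_ge0.
transitivity (\esum_(n in [set: nat]) \esum_(m in [set: nat])
   ((poisson_weight s n * poisson_weight t m)%:E * kernel_power (n + m) x y)).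
  apply: eq_esum => n _; rewrite exchange_esum//; apply: eq_esum => m _.
  rewrite kernel_powerD -esumZl; last 2 first.
  - by rewrite lee_fin mulr_ge0// poisson_weight_ge0.
  - by move=> u; rewrite mule_ge0// kernel_power_ge0.
  by apply: eq_esum => u _; rewrite /a EFinM muleACA.
rewrite esum_antidiagonal; last first.
  move=> n m; rewrite mule_ge0 ?kernel_power_ge0//.
  by rewrite lee_fin mulr_ge0// poisson_weight_ge0.
apply: eq_esum => N _; rewrite -poisson_weight_convolution -sumEFin.
rewrite ge0_sume_distrl => [|i _]; last first.
  by rewrite lee_fin mulr_ge0// poisson_weight_ge0.
apply: eq_bigr => i _; congr (_ * kernel_power _ x y).
by rewrite subnKC// -ltnS ltn_ord.
Qed.

Lemma esum_nat_ge_two_terms (f : nat -> \bar R) : (forall n, 0 <= f n) ->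
  f 0%N + f 1%N <= \esum_(n in [set: nat]) f n.
Proof.
move=> f0; apply: esum_ge; exists `I_2; first by split; first exact: finite_II.
by rewrite -(fsbig_ord _ _ f) 2!big_ord_recl big_ord0 /= addr0.
Qed.

(** The first two terms give the lower bound; applied to the complementary
    probabilities they also give the upper one. *)
Lemma poissonized_expansion t x y : (0 <= t <= 1)%R ->
  (`|fine (poissonized t x y) - (x == y)%:R - t * (K x y - (x == y)%:R)|
    <= t ^+ 2)%R.
Proof.
move=> /andP[t0 t1].
have w0 : poisson_weight t 0 = expR (- t).
  by rewrite /poisson_weight expr0 fact0 divr1 mulr1.
have w1 : poisson_weight t 1 = (expR (- t) * t)%R.
  by rewrite /poisson_weight expr1 (_ : 1`! = 1%N)// divr1.
have kfin n : kernel_power n x y \is a fin_num.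
  by rewrite ge0_fin_numE ?kernel_power_ge0// (le_lt_trans (kernel_power_le1 _ _ _))// ltry.
have lower : (expR (- t) * (x == y)%:R + expR (- t) * t * K x y <=
    fine (poissonized t x y))%R.
  rewrite -lee_fin fineK ?poissonized_fin// EFinD.
  rewrite (EFinM (expR (- t))) (EFinM (expR (- t) * t)%R).
  rewrite -w1 -w0 -kernel_power1; apply: esum_nat_ge_two_terms => n; exact: term_ge0.
have cterm_ge0 n : 0 <= (poisson_weight t n)%:E * (1 - kernel_power n x y).
  by rewrite mule_ge0 ?lee_fin ?poisson_weight_ge0// suber_ge0// kernel_power_le1.
have compl : poissonized t x y +
    \esum_(n in [set: nat]) (poisson_weight t n)%:E * (1 - kernel_power n x y) = 1.
  rewrite -esumD// => [|n _]; last exact: term_ge0.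
  rewrite -[RHS](poisson_weight_sum1 t0); apply: eq_esum => n _.
  rewrite -ge0_muleDr ?kernel_power_ge0 ?suber_ge0 ?kernel_power_le1//.
  by rewrite addeC subeK// mule1.
have upper : (expR (- t) * (1 - (x == y)%:R) + expR (- t) * t * (1 - K x y) <=
    1 - fine (poissonized t x y))%R.
  rewrite -lee_fin EFinB fineK ?poissonized_fin// leeBrDl ?poissonized_fin//.
  rewrite -[leRHS]compl leeD2l// EFinD.
  rewrite (EFinM (expR (- t))) (EFinM (expR (- t) * t)%R) !EFinB.
  rewrite -w1 -w0 -kernel_power1; exact: esum_nat_ge_two_terms.
have e1 : (1 - t <= expR (- t))%R by exact: expR_ge1Dx.
have K1 : (K x y <= 1)%R by rewrite -lee_fin -kernel_power1 kernel_power_le1.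
move: lower upper e1 K1 (K_ge0 x y) => /=.
set p := fine _; set E := expR _; set k := K x y.
have d01 : (0 <= ((x == y)%:R : R) <= 1)%R.
  by rewrite ler0n (ler_nat R _ 1) leq_b1.
move: d01; set d := (x == y)%:R => /andP[d0 d1] lower upper e1 k1 k0.
have l2 : (0 <= (E - (1 - t)) * (d + t * k))%R.
  by rewrite mulr_ge0 ?subr_ge0// addr_ge0// mulr_ge0.
have u2 : (0 <= (E - (1 - t)) * ((1 - d) + t * (1 - k)))%R.
  by rewrite mulr_ge0 ?subr_ge0// addr_ge0 ?mulr_ge0 ?subr_ge0.
have tk : (0 <= t ^+ 2 * k)%R by rewrite mulr_ge0// exprn_ge0.
have tk' : (0 <= t ^+ 2 * (1 - k))%R by rewrite mulr_ge0 ?subr_ge0// exprn_ge0.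
rewrite ler_norml; apply/andP; split; nra.
Qed.

End uniformization.

Section existence.
Context {R : realType} {S : countType}.
Variables (q : S -> S -> R) (L : R).
Hypotheses (L_gt0 : 0 < L) (q_ge0 : forall x y, 0 <= q x y)
  (q_diag : forall x, q x x = 0)
  (q_bounded : forall x, (\esum_(y in [set: S]) (q x y)%:E <= L%:E)%E).

Let jump x y : R := (x == y)%:R * (1 - exit_rate q x / L) + q x y / L.

Let stay_ge0 x : 0 <= 1 - exit_rate q x / L.
Proof.
by rewrite subr_ge0 ler_pdivrMr// mul1r; exact: exit_rate_le q_ge0 q_bounded x.
Qed.

Let jump_ge0 x y : 0 <= jump x y.
Proof. by rewrite addr_ge0 ?mulr_ge0 ?invr_ge0 ?(ltW L_gt0). Qed.

Let jump_sum1 x : (\esum_(y in [set: S]) (jump x y)%:E = 1)%E.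
Proof.
have i0 : (0 <= (L^-1)%:E)%E by rewrite lee_fin invr_ge0 ltW.
have s0 := stay_ge0 x.
under eq_esum do rewrite EFinD !EFinM.
rewrite esumD; last 2 first.
- by move=> y _; rewrite mule_ge0// lee_fin.
- by move=> y _; rewrite mule_ge0// lee_fin.
rewrite (@esum_deltal R S (fun=> (1 - exit_rate q x / L)%:E))//.
rewrite esumZr// => [|y]; last by rewrite lee_fin.
by rewrite (exit_rateE q_ge0 q_bounded) -EFinM -EFinD subrK.
Qed.

(** Uniformization: jumps are attempted at the constant rate L, and an attempt at
    x fails with probability 1 - exit_rate q x / L, which leaves the rates q. *)
Theorem bounded_rates_transition : exists P, transition_function q P.
Proof.
pose P t x y := fine (poissonized jump (L * t) x y).
have Lt0 t : 0 <= t -> 0 <= L * t by move=> t0; rewrite mulr_ge0// ltW.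
have PE t x y : 0 <= t -> ((P t x y)%:E = poissonized jump (L * t) x y)%E.
  by move=> t0; rewrite fineK// poissonized_fin// Lt0.
have expansion x y e : 0 < e -> \forall h \near 0^'+,
    `|(P h x y - (x == y)%:R) / h - L * (jump x y - (x == y)%:R)| <= e.
  move=> e0; near=> h.
  have h0 : 0 < h by near: h; exact: nbhs_right_gt.
  have hL : h < L^-1 by near: h; apply: nbhs_right_lt; rewrite invr_gt0.
  have he : h < e / L ^+ 2.
    by near: h; apply: nbhs_right_lt; rewrite divr_gt0// exprn_gt0.
  have u01 : 0 <= L * h <= 1.
    by rewrite (Lt0 _ (ltW h0))/= mulrC -ler_pdivlMr// div1r ltW.
  have := poissonized_expansion jump_ge0 jump_sum1 x y u01; rewrite -/(P h x y) => Pb.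
  have -> : (P h x y - (x == y)%:R) / h - L * (jump x y - (x == y)%:R) =
    (P h x y - (x == y)%:R - L * h * (jump x y - (x == y)%:R)) / h.
    by field; rewrite gt_eqF.
  rewrite normrM normfV (gtr0_norm h0) ler_pdivrMr//.
  apply: le_trans Pb _; rewrite exprMn (expr2 h) mulrA ler_pM2r//.
  by rewrite mulrC -ler_pdivlMr ?exprn_gt0// ltW.
exists P; split.
- by move=> t x y t0; rewrite fine_ge0// poissonized_ge0// Lt0.
- move=> t x t0; under eq_esum do rewrite PE//.
  by rewrite poissonized_sum1// Lt0.
- by move=> x y; rewrite /P mulr0 poissonized0.
- move=> s t x y s0 t0; under eq_esum do rewrite EFinM !PE//.
  by rewrite poissonizedD ?Lt0// PE ?addr_ge0// mulrDr.
- move=> x y xy; apply/cvgrPdist_le => e e0; near=> h.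
  have : `|(P h x y - (x == y)%:R) / h - L * (jump x y - (x == y)%:R)| <= e.
    by near: h; exact: expansion.
  rewrite /jump (negPf xy) !subr0 mul0r add0r [L * _]mulrC divfK ?gt_eqF//.
  by rewrite distrC.
- move=> x; rewrite (exit_rate_neqE q_ge0 q_diag q_bounded).
  apply: cvg_EFin; first by near=> h.
  apply/cvgrPdist_le => e e0; near=> h.
  have : `|(P h x x - (x == x)%:R) / h - L * (jump x x - (x == x)%:R)| <= e.
    by near: h; exact: expansion.
  rewrite /jump eqxx q_diag mul0r addr0 mul1r.
  have -> : L * (1 - exit_rate q x / L - 1) = - exit_rate q x.
    by field; rewrite gt_eqF.
  move=> b; apply: le_trans b; rewrite le_eqVlt; apply/orP; left; apply/eqP.
  by congr `|_| => /=; ring.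
Unshelve. all: by end_near.
Qed.

End existence.

(** * The function tau and the weights w and nu *)

Section tau_zeros.
Context {R : realType}.
Variables (lambda mu1 mu2 : R).
Hypotheses (lambda_gt0 : 0 < lambda) (lambda_mu1 : lambda < mu1)
  (mu1_mu2 : mu1 < mu2).

Let k := Num.sqrt (lambda * mu1).
Let C := lambda + mu1 + mu2.

Let lm_ge0 : 0 <= lambda * mu1.
Proof. by rewrite mulr_ge0 ?ltW// (lt_trans lambda_gt0). Qed.

Let k2_lt : 2 * k < lambda + mu1.
Proof.
have k0 : 0 <= k by exact: sqrtr_ge0.
have kk : k ^+ 2 = lambda * mu1 by exact: sqr_sqrtr.
rewrite ltNge; apply/negP => le.
have : (lambda + mu1) ^+ 2 <= (2 * k) ^+ 2.
  have lm0 : 0 <= lambda + mu1 by move: lambda_gt0 lambda_mu1; lra.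
  by rewrite ler_sqr ?nnegrE// (le_trans lm0).
have : 0 < (mu1 - lambda) ^+ 2 by rewrite exprn_gt0// subr_gt0.
rewrite exprMn kk; nra.
Qed.

(** In the variable s = sqrt x the zeros of tau become those of a cubic without
    quadratic term. *)
Lemma tau_cubic (x : R) : 0 < x ->
  Num.sqrt x * tau lambda mu1 mu2 x =
  mu2 * Num.sqrt x ^+ 3 - C * Num.sqrt x + 2 * k.
Proof.
move=> x0; have s0 : Num.sqrt x != 0 by rewrite sqrtr_eq0 -ltNge.
rewrite /tau sqrtrM// sqrtrV ?ltW// -/k exprS sqr_sqrtr ?ltW// /C.
by field.
Qed.

Let cubic_factor s b : mu2 * b ^+ 3 - C * b + 2 * k = 0 ->
  mu2 * s ^+ 3 - C * s + 2 * k =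
  (s - b) * (mu2 * (s ^+ 2 + s * b + b ^+ 2) - C).
Proof. by move=> e; rewrite -[LHS]subr0 -[X in _ - X]e; ring. Qed.

Let sqrt01 (x : R) : 0 < x < 1 -> 0 < Num.sqrt x < 1.
Proof.
by move=> /andP[x0 x1]; rewrite sqrtr_gt0 x0/= -[ltRHS]sqrtr1 ltr_sqrt.
Qed.

Let cubic_quotient_lt0 (b : R) : 0 < b < 1 -> mu2 * b ^+ 3 - C * b + 2 * k = 0 ->
  mu2 * (1 + b + b ^+ 2) < C.
Proof.
move=> /andP[b0 b1] /(cubic_factor 1).
rewrite !expr1n !mulr1 mul1r => e.
have : (1 - b) * (mu2 * (1 + b + b ^+ 2) - C) < 0.
  have := k2_lt; rewrite -e /C; set m := 2 * k => ?; lra.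
by rewrite pmulr_rlt0 ?subr_gt0// subr_lt0.
Qed.

(** Once a zero s = b is divided out, the quotient is increasing in s > 0 and
    negative at s = 1, where the cubic is negative. *)
Lemma tau_le0_of_zero (x y : R) : 0 < x < 1 -> tau lambda mu1 mu2 x = 0 ->
  x <= y < 1 -> tau lambda mu1 mu2 y <= 0 ?= iff (x == y).
Proof.
move=> x01 tx /andP[xy y1].
have [x0 x1] := andP x01.
have y0 : 0 < y := lt_le_trans x0 xy.
have y01 : 0 < y < 1 by rewrite y0.
have [b0 b1] := andP (sqrt01 x01); have [s0 s1] := andP (sqrt01 y01).
have e : mu2 * Num.sqrt x ^+ 3 - C * Num.sqrt x + 2 * k = 0.
  by rewrite -tau_cubic// tx mulr0.
have neg := cubic_quotient_lt0 (sqrt01 x01) e.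
have quot : mu2 * (Num.sqrt y ^+ 2 + Num.sqrt y * Num.sqrt x + Num.sqrt x ^+ 2) - C < 0.
  rewrite subr_lt0; apply: le_lt_trans neg.
  rewrite ler_pM2l; last by rewrite (lt_trans _ mu1_mu2)// (lt_trans lambda_gt0).
  by nra.
have [<-|xy'] := eqVneq x y; first by rewrite tx; exact/leifP.
apply/leifP; rewrite -(pmulr_rlt0 _ s0) tau_cubic// (cubic_factor _ e).
by rewrite nmulr_llt0// subr_gt0 ltr_sqrt// lt_neqAle xy'.
Qed.

Lemma tau_zero_unique (x y : R) : 0 < x < 1 -> 0 < y < 1 ->
  tau lambda mu1 mu2 x = 0 -> tau lambda mu1 mu2 y = 0 -> x = y.
Proof.
wlog xy : x y / x <= y.
  move=> wl x01 y01 tx ty; have [xy|/ltW yx] := leP x y; first exact: wl.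
  by apply/esym; exact: wl.
move=> x01 /andP[_ y1] tx ty.
have xy1 : x <= y < 1 by rewrite xy.
by have [_] := tau_le0_of_zero x01 tx xy1; rewrite ty eqxx => /esym/eqP.
Qed.

Lemma tau_le0_discriminant (z : R) : 0 < z < 1 -> tau lambda mu1 mu2 z <= 0 ->
  4 * (lambda * mu1) <= z * (lambda + mu1 + mu2 * (1 - z)) ^+ 2.
Proof.
move=> /andP[z0 z1]; have s0 : 0 < Num.sqrt z by rewrite sqrtr_gt0.
rewrite -(pmulr_rle0 _ s0) tau_cubic//.
have zz : Num.sqrt z ^+ 2 = z by rewrite sqr_sqrtr ?ltW.
have -> : mu2 * Num.sqrt z ^+ 3 - C * Num.sqrt z + 2 * k =
    2 * k - Num.sqrt z * (lambda + mu1 + mu2 * (1 - z)).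
  by rewrite exprS zz /C; ring.
rewrite subr_le0 => le.
have -> : 4 * (lambda * mu1) = (2 * k) ^+ 2.
  by rewrite exprMn /k sqr_sqrtr//; ring.
set B := lambda + mu1 + _ in le *.
have -> : z * B ^+ 2 = (Num.sqrt z * B) ^+ 2 by rewrite exprMn zz.
have k0 : 0 <= 2 * k by rewrite mulr_ge0// sqrtr_ge0.
by rewrite ler_sqr ?nnegrE// (le_trans k0).
Qed.

End tau_zeros.

Section weights.
Context {R : realType}.
Variables (lambda mu1 mu2 z : R) (w nu : nat -> R).
Hypotheses (lambda_gt0 : 0 < lambda) (lambda_mu1 : lambda < mu1)
  (mu1_mu2 : mu1 < mu2) (z_gt0 : 0 < z) (mu2z_le : mu2 * z <= lambda)
  (disc : 4 * (lambda * mu1) <= z * (lambda + mu1 + mu2 * (1 - z)) ^+ 2).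
Hypotheses (w0 : w 0%N = 1)
  (w1 : mu1 * w 1%N = (lambda + mu2 * (1 - z)) * z)
  (wS : forall k : nat, (1 <= k)%N ->
     mu1 * w k.+1 = (lambda + mu1 + mu2 * (1 - z)) * z * w k
                    - lambda * z * w k.-1)
  (nu1 : nu 1%N = (lambda - mu2 * z) * w 0%N / w 1%N)
  (nuS : forall i : nat, (1 <= i)%N ->
     nu i.+1 = ((nu i + lambda + mu1 - mu2 * z) * w i - lambda * w i.-1)
               / w i.+1).

Let mu1_gt0 : 0 < mu1. Proof. exact: lt_trans lambda_mu1. Qed.
Let mu2_gt0 : 0 < mu2. Proof. exact: lt_trans mu1_mu2. Qed.
Let z_lt1 : z < 1.
Proof.
rewrite -(ltr_pM2l mu2_gt0) mulr1; apply: le_lt_trans mu2z_le _.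
exact: lt_trans mu1_mu2.
Qed.

Let A := lambda + mu1 + mu2 * (1 - z).

(** The roots r1 and r2 of the characteristic polynomial f of the recurrence are
    real by the bound on the discriminant, which comes from tau z <= 0. They lie
    below 1 as f 1 > 0 and r1 * r2 < 1, and not below z as f z >= 0 and z is
    smaller than their mean. *)
Lemma characteristic_roots : exists r1 r2 : R,
  [/\ mu1 * (r1 + r2) = A * z, mu1 * (r1 * r2) = lambda * z,
      0 < r1 <= r2, z <= r1 & r2 < 1].
Proof.
pose D := Num.sqrt ((A * z) ^+ 2 - 4 * (lambda * mu1) * z).
have D2 : D ^+ 2 = (A * z) ^+ 2 - 4 * (lambda * mu1) * z.
  rewrite sqr_sqrtr//.
  have -> : (A * z) ^+ 2 - 4 * (lambda * mu1) * z =
    z * (z * A ^+ 2 - 4 * (lambda * mu1)) by ring.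
  by rewrite mulr_ge0 ?subr_ge0// ltW.
have D0 : 0 <= D by exact: sqrtr_ge0.
have m0 : mu1 != 0 by rewrite gt_eqF.
pose r1 := (A * z - D) / (2 * mu1); pose r2 := (A * z + D) / (2 * mu1).
have sE : mu1 * (r1 + r2) = A * z by rewrite /r1 /r2; field.
have pE : mu1 * (r1 * r2) = lambda * z.
  have -> : mu1 * (r1 * r2) = ((A * z) ^+ 2 - D ^+ 2) / (4 * mu1).
    by rewrite /r1 /r2; field.
  by rewrite D2; field.
have r12 : r1 <= r2 by rewrite /r1 /r2 ler_pM2r ?invr_gt0 ?mulr_gt0// lerD2l ge0_cp.
have f1 : mu1 * ((1 - r1) * (1 - r2)) = (1 - z) * (mu1 - mu2 * z).
  have -> : mu1 * ((1 - r1) * (1 - r2)) =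
    mu1 - mu1 * (r1 + r2) + mu1 * (r1 * r2) by ring.
  by rewrite sE pE /A; ring.
have fz : mu1 * ((z - r1) * (z - r2)) = z * (1 - z) * (lambda - mu2 * z).
  have -> : mu1 * ((z - r1) * (z - r2)) =
    mu1 * z ^+ 2 - mu1 * (r1 + r2) * z + mu1 * (r1 * r2) by ring.
  by rewrite sE pE /A; ring.
have f1_gt0 : 0 < (1 - r1) * (1 - r2).
  by rewrite -(pmulr_rgt0 _ mu1_gt0) f1 mulr_gt0// subr_gt0// (le_lt_trans mu2z_le).
have fz_ge0 : 0 <= (z - r1) * (z - r2).
  rewrite -(pmulr_rge0 _ mu1_gt0) fz mulr_ge0 ?subr_ge0//.
  by rewrite mulr_ge0 ?subr_ge0 ?ltW.
have p_gt0 : 0 < r1 * r2.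
  by rewrite -(pmulr_rgt0 _ mu1_gt0) pE mulr_gt0.
have p_lt1 : r1 * r2 < 1.
  by rewrite -(ltr_pM2l mu1_gt0) pE mulr1 (lt_trans _ lambda_mu1)// gtr_pMr.
have s_gt2z : 2 * z < r1 + r2.
  rewrite -(ltr_pM2l mu1_gt0) sE mulrA ltr_pM2r// /A.
  by move: mu2z_le mu1_mu2; lra.
have zr1 : z <= r1 by rewrite leNgt; apply/negP => h; nra.
exists r1, r2; split => //; first by rewrite r12 andbT; exact: lt_le_trans zr1.
by rewrite ltNge; apply/negP => h; nra.
Qed.

(** The differences w k.+1 - r1 * w k form a geometric progression of ratio r2
    that starts with w 1 - r1 = r2 - z >= 0. *)
Lemma w_growth : exists r : R, [/\ 0 < r, lambda * z <= mu1 * r,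
  forall k, 0 < w k & forall k, r * w k <= w k.+1].
Proof.
have [r1 [r2 [sE pE /andP[r1_gt0 r12] zr1 r2_lt1]]] := characteristic_roots.
have r2_gt0 := lt_le_trans r1_gt0 r12.
have m0 : mu1 != 0 by rewrite gt_eqF.
have diff k : w k.+1 - r1 * w k = (r2 - z) * r2 ^+ k.
  elim: k => [|k IHk]; apply: (mulfI m0).
    have -> : mu1 * ((r2 - z) * r2 ^+ 0) = mu1 * (r1 + r2) - mu1 * z - mu1 * r1.
      by rewrite expr0; ring.
    by rewrite mulrBr w1 w0 sE /A; ring.
  have -> : (r2 - z) * r2 ^+ k.+1 = r2 * (w k.+1 - r1 * w k).
    by rewrite IHk exprS; ring.
  by rewrite mulrBr wS//= -/A -sE -pE; ring.
have growth k : r1 * w k <= w k.+1.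
  by rewrite -subr_ge0 diff mulr_ge0 ?exprn_ge0 ?(ltW r2_gt0)// subr_ge0 (le_trans zr1).
exists r1; split => //.
  by rewrite -pE ler_pM2l// ger_pMr// ltW.
elim=> [|k IHk]; first by rewrite w0.
by apply: lt_le_trans (growth k); rewrite mulr_gt0.
Qed.

Lemma w_gt0 k : 0 < w k.
Proof. by have [r []] := w_growth. Qed.

(** The recurrence telescopes; the remainder mu1 * w n.+1 - lambda * z * w n is
    nonnegative. *)
Lemma w_partial_sum_le n : \sum_(0 <= i < n) w i <= mu1 / (mu1 - mu2 * z).
Proof.
have d_gt0 : 0 < mu1 - mu2 * z by rewrite subr_gt0 (le_lt_trans mu2z_le).
have z1 : 0 < 1 - z by rewrite subr_gt0.
apply: (@le_trans _ _ (\sum_(0 <= i < n.+1) w i)).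
  by rewrite big_nat_recr//= lerDl ltW// w_gt0.
have telescope : (1 - z) * (mu1 - mu2 * z) * (\sum_(0 <= i < n.+1) w i) =
    mu1 * (1 - z) - (mu1 * w n.+1 - lambda * z * w n).
  elim: n => [|n IHn]; first by rewrite big_nat1 w1 w0; ring.
  by rewrite big_nat_recr// mulrDr IHn (wS (k := n.+1))//=; ring.
have [r [r0 pr _ growth]] := w_growth.
rewrite ler_pdivlMr// -(ler_pM2l z1) mulrCA mulrC telescope.
rewrite [(1 - z) * _]mulrC gerBl subr_ge0.
apply: (@le_trans _ _ (mu1 * r * w n)); first by rewrite ler_wpM2r// ltW// w_gt0.
by rewrite -mulrA ler_pM2l.
Qed.

(** The Casorati determinants of w form a geometric progression of ratio
    lambda * z / mu1, so they keep the sign of the first one. *)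
Lemma w_log_concave k : w k.+2 * w k <= w k.+1 ^+ 2.
Proof.
rewrite -subr_ge0 -(pmulr_rge0 _ mu1_gt0).
elim: k => [|k IHk].
  have -> : mu1 * (w 1%N ^+ 2 - w 2%N * w 0%N) = z * (1 - z) * (lambda - mu2 * z).
    rewrite w0 mulrBr mulr1 wS//= w0.
    have -> : mu1 * w 1%N ^+ 2 = (mu1 * w 1%N) * w 1%N by ring.
    rewrite w1; apply: (mulfI (lt0r_neq0 mu1_gt0)).
    have -> : forall v, mu1 * ((lambda + mu2 * (1 - z)) * z * v -
      ((lambda + mu1 + mu2 * (1 - z)) * z * v - lambda * z * 1)) =
      mu1 * (lambda * z) - mu1 * z * (mu1 * v) by move=> v; ring.
    by rewrite w1; ring.
  by rewrite mulr_ge0 ?subr_ge0// mulr_ge0 ?subr_ge0 ?ltW.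
have -> : mu1 * (w k.+2 ^+ 2 - w k.+3 * w k.+1) =
    lambda * z * (w k.+1 ^+ 2 - w k.+2 * w k).
  have -> : mu1 * (w k.+2 ^+ 2 - w k.+3 * w k.+1) =
    (mu1 * w k.+2) * w k.+2 - (mu1 * w k.+3) * w k.+1 by ring.
  by rewrite !wS//=; ring.
have lz0 : 0 <= lambda * z by rewrite mulr_ge0 ?ltW.
by rewrite mulr_ge0// -(pmulr_rge0 _ mu1_gt0).
Qed.

Lemma w_submultiplicative k : w k.+1 <= w 1%N * w k.
Proof.
elim: k => [|k IHk]; first by rewrite w0 mulr1.
rewrite -(ler_pM2r (w_gt0 k)); apply: le_trans (w_log_concave k) _.
by rewrite expr2 mulrAC -mulrA [w k * _]mulrC mulrCA ler_pM2l ?w_gt0// .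
Qed.

(** The recurrence of nu gives the increments of nu i * w i, and that of w turns
    them into mu1 * w i.+1 / z - mu2 * w i, which are also the increments of a
    linear combination of w i and w i.+1. *)
Lemma nu_closed i : (1 <= i)%N ->
  nu i * w i = mu1 / (z * (1 - z)) * (w 1%N * w i - w i.+1).
Proof.
have z1 : 1 - z != 0 by rewrite gt_eqF// subr_gt0.
have z0 : z != 0 by rewrite gt_eqF.
have wn0 k : w k != 0 by rewrite gt_eqF ?w_gt0.
have w1E : w 1%N = (lambda + mu2 * (1 - z)) * z / mu1.
  by rewrite -w1 mulrC mulKf// gt_eqF.
have wE k : w k.+2 =
    ((lambda + mu1 + mu2 * (1 - z)) * z * w k.+1 - lambda * z * w k) / mu1.
  by rewrite -[X in X / _](wS (k := k.+1))// mulrC mulKf// gt_eqF.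
case: i => // i _; elim: i => [|i IHi].
  rewrite nu1 divfK// wE w0 w1E; field.
  by rewrite z1 z0 gt_eqF.
rewrite nuS// divfK//=.
have -> : (nu i.+1 + lambda + mu1 - mu2 * z) * w i.+1 - lambda * w i =
   nu i.+1 * w i.+1 + (lambda + mu1 - mu2 * z) * w i.+1 - lambda * w i by ring.
rewrite IHi wE [w i.+3]wE (wE i) w1E; field.
by rewrite z1 z0 gt_eqF.
Qed.

Lemma nu_ge0 i : (1 <= i)%N -> 0 <= nu i.
Proof.
move=> i1; rewrite -(pmulr_lge0 _ (w_gt0 i)) nu_closed//.
rewrite mulr_ge0//; last by rewrite subr_ge0 w_submultiplicative.
by rewrite divr_ge0 ?mulr_ge0 ?subr_ge0 ?ltW.
Qed.

Lemma nu_le i : (1 <= i)%N -> nu i <= mu1 / (z * (1 - z)) * w 1%N.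
Proof.
move=> i1; rewrite -(ler_pM2r (w_gt0 i)) nu_closed// -[leRHS]mulrA ler_wpM2l//.
  by rewrite divr_ge0 ?mulr_ge0 ?subr_ge0 ?ltW.
by rewrite gerBl ltW// w_gt0.
Qed.

End weights.

(** * The modified tandem network *)

Section rates.
Context {R : realType}.
Variables (lambda mu1 mu2 : R) (nu : nat -> R).
Hypotheses (lambda_gt0 : 0 < lambda) (mu1_gt0 : 0 < mu1) (mu2_gt0 : 0 < mu2)
  (nu_ge0 : forall i, (1 <= i)%N -> 0 <= nu i).

Let q := modified_tandem_rate lambda mu1 mu2 nu.

Let lambda_ge0 := ltW lambda_gt0.
Let mu1_ge0 := ltW mu1_gt0.
Let mu2_ge0 := ltW mu2_gt0.

Lemma tandem_rate_ge0 x y : 0 <= q x y.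
Proof.
case: x => k j; rewrite /q /modified_tandem_rate !addr_ge0//; case: ifP => //.
by move=> /and3P[_ j0 _]; exact: nu_ge0.
Qed.

Lemma tandem_rate_diag x : q x x = 0.
Proof.
case: x => k j; rewrite /q /modified_tandem_rate !xpair_eqE.
by case: k => [|k]; case: j => [|j] /=; rewrite ?eqxx ?(ltn_eqF (ltnSn _)) ?(gtn_eqF (ltnSn _)) ?andbF ?addr0.
Qed.

Lemma tandem_row_sum k j :
  (\esum_(y in [set: nat * nat]) (q (k, j) y)%:E =
   (lambda + (if (0 < j)%N then mu1 else 0) + (if (0 < k)%N then mu2 else 0)
    + (if (k == 0%N) && (0 < j)%N then nu j else 0))%:E)%E.
Proof.
apply: (esum_if4 (p1 := (k, j.+1)) (p2 := (k.+1, j.-1)) (p3 := (k.-1, j))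
   (p4 := (0%N, j.-1))) => //; try by case: ifP.
  by case: ifP => // /andP[_]; exact: nu_ge0.
move=> y; rewrite /q /modified_tandem_rate andbA.
congr (_ + _ + _ + _).
- by case: (0 < j)%N; case: eqP.
- by case: (0 < k)%N; case: eqP.
- by case: ((k == 0%N) && (0 < j)%N); case: eqP.
Qed.

Lemma tandem_exit_rate k j : exit_rate q (k, j) =
  lambda + (if (0 < j)%N then mu1 else 0) + (if (0 < k)%N then mu2 else 0)
    + (if (k == 0%N) && (0 < j)%N then nu j else 0).
Proof. by rewrite /exit_rate tandem_row_sum. Qed.

Lemma tandem_column_sum (pi : nat * nat -> R) a b : (forall x, 0 <= pi x) ->
  (\esum_(x in [set: nat * nat]) (pi x * q x (a, b))%:E =
   ((if (0 < b)%N then pi (a, b.-1) * lambda else 0)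
    + (if (0 < a)%N then pi (a.-1, b.+1) * mu1 else 0)
    + pi (a.+1, b) * mu2
    + (if a == 0%N then pi (0%N, b.+1) * nu b.+1 else 0))%:E)%E.
Proof.
move=> pi0; apply: (esum_if4 (p1 := (a, b.-1)) (p2 := (a.-1, b.+1))
   (p3 := (a.+1, b)) (p4 := (0%N, b.+1))).
- by case: ifP => // _; rewrite mulr_ge0.
- by case: ifP => // _; rewrite mulr_ge0.
- by rewrite mulr_ge0.
- by case: ifP => // _; rewrite mulr_ge0// nu_ge0.
move=> [k j]; rewrite /q /modified_tandem_rate !mulrDr !xpair_eqE.
congr (_ + _ + _ + _).
- case: b => [|b] /=; first by rewrite andbF mulr0; case: ifP.
  rewrite eqSS [a == k]eq_sym [b == j]eq_sym.
  by case: (eqVneq k a) => [->|]; case: (eqVneq j b) => [->|]; rewrite ?mulr0.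
- case: a => [|a] /=; first by rewrite andbF mulr0; case: ifP.
  rewrite eqSS [a == k]eq_sym; case: j => [|j] /=; first by rewrite andbF mulr0.
  rewrite eqSS [b == j]eq_sym.
  by case: (eqVneq k a) => [->|]; case: (eqVneq j b) => [->|]; rewrite ?mulr0.
- case: k => [|k] /=; first by rewrite mulr0.
  rewrite eqSS [a == k]eq_sym [b == j]eq_sym.
  by case: (eqVneq k a) => [->|]; case: (eqVneq j b) => [->|]; rewrite ?mulr0.
- case: k => [|k] /=; last by rewrite mulr0.
  case: j => [|j] /=; first by rewrite mulr0.
  rewrite eqSS [b == j]eq_sym.
  by case: (eqVneq a 0%N) => [_|_]; case: (eqVneq j b) => [->|]; rewrite ?mulr0//=; case: ifP.
Qed.

Let summand_ge0 (b : bool) (v : R) : 0 <= v -> 0 <= (if b then v else 0).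
Proof. by case: b. Qed.

Let nu_summand_ge0 (k j : nat) (y : nat * nat) :
  0 <= (if [&& k == 0%N, (0 < j)%N & y == (0%N, j.-1)] then nu j else 0).
Proof. by case: ifP => // /and3P[_ j0 _]; exact: nu_ge0. Qed.

Lemma arrival_gt0 k j : 0 < q (k, j) (k, j.+1).
Proof.
rewrite /q /modified_tandem_rate eqxx.
by rewrite !ltr_wpDr// summand_ge0.
Qed.

Lemma transfer_gt0 k j : 0 < q (k, j.+1) (k.+1, j).
Proof.
rewrite /q /modified_tandem_rate /= eqxx.
apply: ltr_wpDr; first by case: ifP => // _; exact: nu_ge0.
apply: ltr_wpDr; first exact: summand_ge0.
by apply: ltr_wpDl => //; exact: summand_ge0.
Qed.

Lemma departure_gt0 k j : 0 < q (k.+1, j) (k, j).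
Proof.
rewrite /q /modified_tandem_rate /= eqxx addr0.
by apply: ltr_wpDl => //; rewrite addr_ge0// summand_ge0.
Qed.

(** Along the three transitions of positive rate every state is reached from
    every other one: the empty state by emptying the queues, and from it all the
    states. *)
Lemma tandem_irreducible (Z : set (nat * nat)) :
  (forall x y, Z y -> 0 < q x y -> Z x) -> forall x y, Z x -> Z y.
Proof.
move=> Zq.
have Z1 k j : Z (k, j.+1) -> Z (k, j).
  by move=> zk; apply: Zq zk _; exact: arrival_gt0.
have Z2 k j : Z (k.+1, j) -> Z (k, j.+1).
  by move=> zk; apply: Zq zk _; exact: transfer_gt0.
have Z3 k j : Z (k, j) -> Z (k.+1, j).
  by move=> zk; apply: Zq zk _; exact: departure_gt0.
move=> [k j] [k' j'] zkj.
have Z00 : Z (0, 0)%N.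
  have {zkj} : Z (k, 0%N) by elim: j zkj => [//|j IHj] /Z1.
  by elim: k => [//|k IHk] /Z2/Z1.
have Zk0 n : Z (n, 0%N) by elim: n => [//|n IHn]; exact: Z3.
by elim: j' k' => [//|j' IHj] k'; exact: Z2.
Qed.

Section product_form.
Variables (z : R) (w : nat -> R).
Hypotheses (z_gt0 : 0 < z) (w_gt0 : forall i, 0 < w i).
Hypotheses (w0 : w 0%N = 1)
  (w1 : mu1 * w 1%N = (lambda + mu2 * (1 - z)) * z)
  (wS : forall k : nat, (1 <= k)%N ->
     mu1 * w k.+1 = (lambda + mu1 + mu2 * (1 - z)) * z * w k
                    - lambda * z * w k.-1)
  (nu1 : nu 1%N = (lambda - mu2 * z) * w 0%N / w 1%N)
  (nuS : forall i : nat, (1 <= i)%N ->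
     nu i.+1 = ((nu i + lambda + mu1 - mu2 * z) * w i - lambda * w i.-1)
               / w i.+1).

Lemma product_form_balance (c : R) : 0 <= c ->
  global_balance q (fun x => c * z ^+ x.1 * w x.2).
Proof.
move=> c0 [a b].
have wn0 k : w k != 0 by rewrite gt_eqF.
rewrite tandem_column_sum => [|x]; last first.
  by rewrite mulr_ge0 ?(ltW (w_gt0 _))// mulr_ge0// exprn_ge0// ltW.
rewrite tandem_exit_rate; congr EFin => /=.
case: a => [|a]; case: b => [|b] /=; rewrite ?ltnS ?leq0n ?addr0 ?add0r ?expr0 ?expr1 ?mulr1.
- have -> : c * w 1%N * nu 1%N = c * (nu 1%N * w 1%N) by ring.
  by rewrite nu1 divfK// w0; ring.
- have -> : c * w b.+2 * nu b.+2 = c * (nu b.+2 * w b.+2) by ring.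
  by rewrite nuS// divfK//=; ring.
- have -> : c * z ^+ a * w 1%N * mu1 = c * z ^+ a * (mu1 * w 1%N) by ring.
  by rewrite w1 w0 !exprS; ring.
- have -> : c * z ^+ a * w b.+2 * mu1 = c * z ^+ a * (mu1 * w b.+2) by ring.
  by rewrite wS//= !exprS; ring.
Qed.

End product_form.
End rates.

(** * The stationary distribution *)

Section summation.
Context {R : realType}.

Lemma esum_nat_le (f : nat -> R) (B : R) : (forall n, 0 <= f n) ->
  (forall n, \sum_(0 <= i < n) f i <= B) ->
  (\esum_(n in [set: nat]) (f n)%:E <= B%:E)%E.
Proof.
move=> f0 fB; have f0E n : (0 <= (f n)%:E)%E by rewrite lee_fin.
rewrite -nneseries_esumT//; apply: lime_le; first exact: is_cvg_nneseries.
by apply: nearW => n; rewrite sumEFin lee_fin.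
Qed.

Lemma geometric_sum_le (z : R) n : 0 < z < 1 ->
  \sum_(0 <= i < n) z ^+ i <= (1 - z)^-1.
Proof.
move=> /andP[z0 z1]; have z1' : 0 < 1 - z by rewrite subr_gt0.
rewrite -(ler_pM2l z1') mulfV ?gt_eqF// big_mkord -opprB mulNr -subrX1 opprB.
by rewrite gerBl exprn_ge0// ltW.
Qed.

Lemma product_normalization (f g : nat -> R) (A B : R) :
  (forall n, 0 < f n) -> (forall n, 0 < g n) ->
  (forall n, \sum_(0 <= i < n) f i <= A) ->
  (forall n, \sum_(0 <= i < n) g i <= B) ->
  exists c W : R, [/\ 0 < c, 0 < W,
    (\esum_(n in [set: nat]) (g n)%:E = W%:E)%E &
    (\esum_(x in [set: nat * nat]) (c * f x.1 * g x.2)%:E = 1)%E].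
Proof.
move=> f0 g0 fA gB.
have sum_fin (h : nat -> R) C : (forall n, 0 < h n) ->
    (forall n, \sum_(0 <= i < n) h i <= C) ->
    exists2 W, 0 < W & (\esum_(n in [set: nat]) (h n)%:E = W%:E)%E.
  move=> h0 hC; have h0E n : (0 <= (h n)%:E)%E by rewrite lee_fin ltW.
  have hfin : (\esum_(n in [set: nat]) (h n)%:E)%E \is a fin_num.
    rewrite ge0_fin_numE ?esum_ge0//.
    by apply: le_lt_trans (esum_nat_le (fun n => ltW (h0 n)) hC) _; rewrite ltry.
  exists (fine (\esum_(n in [set: nat]) (h n)%:E)%E); last by rewrite fineK.
  rewrite -lte_fin fineK//; apply: (@lt_le_trans _ _ (h 0%N)%:E).
    by rewrite lte_fin.
  exact: (esum_ge_term (f := fun n => (h n)%:E)).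
have [F F0 sF] := sum_fin f A f0 fA.
have [W W0 sW] := sum_fin g B g0 gB.
have c0 : 0 < (F * W)^-1 by rewrite invr_gt0 mulr_gt0.
exists (F * W)^-1, W; split => //.
have cf0 n : 0 <= (F * W)^-1 * f n by rewrite mulr_ge0 ?ltW.
rewrite -(pair_esum (a := fun i j => ((F * W)^-1 * f i * g j)%:E)) => [|i j]; last first.
  by rewrite lee_fin mulr_ge0 ?(ltW (g0 _)).
transitivity (\esum_(i in [set: nat]) ((F * W)^-1 * W)%:E * (f i)%:E)%E.
  apply: eq_esum => i _; under eq_esum do rewrite EFinM.
  rewrite esumZl ?lee_fin//; last by move=> j; rewrite lee_fin ltW.
  by rewrite sW -!EFinM mulrAC.
rewrite esumZl ?lee_fin ?mulr_ge0 ?ltW// => [|i]; last by rewrite lee_fin ltW.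
rewrite sF -EFinM; congr EFin; field.
by rewrite !gt_eqF.
Qed.

Lemma queue2_product (f g : nat -> R) (c W : R) :
  0 <= c -> (forall n, 0 <= f n) -> (forall n, 0 <= g n) ->
  (\esum_(n in [set: nat]) (g n)%:E = W%:E)%E ->
  forall n, queue2_distribution (fun x => c * f x.1 * g x.2) n = c * f n * W.
Proof.
move=> c0 f0 g0 gW n; rewrite /queue2_distribution.
rewrite (reindex_esum [set: nat] _ (fun j => (n, j))); last first.
  by split => //= [j j' _ _ [->]//|[i j] /= ->]; exists j.
under eq_esum do rewrite /= EFinM.
by rewrite esumZl ?lee_fin ?mulr_ge0// gW -EFinM.
Qed.

End summation.

Theorem mainTheorem5 (R : realType) (lambda mu1 mu2 eta z : R)
    (w nu : nat -> R)
    (lambda_gt0 : 0 < lambda) (lambda_mu1 : lambda < mu1) (mu1_mu2 : mu1 < mu2)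
    (eta01 : 0 < eta < 1) (tau_eta : tau lambda mu1 mu2 eta = 0)
    (z_itv : eta <= z <= lambda / mu2)
    (w0 : w 0%N = 1)
    (w1 : mu1 * w 1%N = (lambda + mu2 * (1 - z)) * z)
    (wS : forall k : nat, (1 <= k)%N ->
       mu1 * w k.+1 = (lambda + mu1 + mu2 * (1 - z)) * z * w k
                      - lambda * z * w k.-1)
    (nu1 : nu 1%N = (lambda - mu2 * z) * w 0%N / w 1%N)
    (nuS : forall i : nat, (1 <= i)%N ->
       nu i.+1 = ((nu i + lambda + mu1 - mu2 * z) * w i - lambda * w i.-1)
                 / w i.+1) :
  let q := modified_tandem_rate lambda mu1 mu2 nu in
  [/\ forall x : R, 0 < x < 1 -> tau lambda mu1 mu2 x = 0 -> x = eta,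
      forall i : nat, 0 < w i,
      forall i : nat, (1 <= i)%N -> 0 <= nu i,
      exists P : R -> nat * nat -> nat * nat -> R, transition_function q P &
      exists c : R,
        forall P : R -> nat * nat -> nat * nat -> R, transition_function q P ->
          (forall pi : nat * nat -> R,
             stationary_distribution P pi <->
             forall n j : nat, pi (n, j) = c * z ^+ n * w j)
          /\
          (forall pi : nat * nat -> R,
             stationary_distribution P pi ->
             has_decay_rate (queue2_distribution pi) z)].
Proof.
move=> q.
have mu1_gt0 : 0 < mu1 := lt_trans lambda_gt0 lambda_mu1.
have mu2_gt0 : 0 < mu2 := lt_trans mu1_gt0 mu1_mu2.
have [/andP[eta0 eta1] /andP[eta_z zle]] := (eta01, z_itv).
have z_gt0 : 0 < z := lt_le_trans eta0 eta_z.
have mu2z_le : mu2 * z <= lambda by rewrite mulrC -ler_pdivlMr.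
have z_lt1 : z < 1.
  by rewrite (le_lt_trans zle)// ltr_pdivrMr// mul1r (lt_trans lambda_mu1).
have z01 : 0 < z < 1 by rewrite z_gt0.
have disc : 4 * (lambda * mu1) <= z * (lambda + mu1 + mu2 * (1 - z)) ^+ 2.
  apply: tau_le0_discriminant => //.
  have eta_z1 : eta <= z < 1 by rewrite eta_z.
  by have [] := tau_le0_of_zero lambda_gt0 lambda_mu1 mu1_mu2 eta01 tau_eta eta_z1.
have wpos i : 0 < w i.
  exact: (w_gt0 lambda_gt0 lambda_mu1 mu1_mu2 z_gt0 mu2z_le disc w0 w1 wS).
have nu0 i : (1 <= i)%N -> 0 <= nu i.
  exact: (nu_ge0 lambda_gt0 lambda_mu1 mu1_mu2 z_gt0 mu2z_le disc w0 w1 wS nu1 nuS).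
pose N := mu1 / (z * (1 - z)) * w 1%N.
have nuN i : (1 <= i)%N -> nu i <= N.
  exact: (nu_le lambda_gt0 lambda_mu1 mu1_mu2 z_gt0 mu2z_le disc w0 w1 wS nu1 nuS).
have N0 : 0 <= N := le_trans (nu0 1%N isT) (nuN 1%N isT).
pose L := lambda + mu1 + mu2 + N.
have L_gt0 : 0 < L by rewrite /L; move: lambda_gt0 mu1_gt0 mu2_gt0 N0; lra.
have q_ge0 := tandem_rate_ge0 lambda_gt0 mu1_gt0 mu2_gt0 nu0.
have q_diag := tandem_rate_diag lambda mu1 mu2 nu.
have q_bounded x : (\esum_(y in [set: nat * nat]) (q x y)%:E <= L%:E)%E.
  case: x => k j; rewrite tandem_row_sum// lee_fin /L.
  rewrite !lerD//; try by case: ifP => // _; exact: ltW.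
  by case: ifP => // /andP[_]; exact: nuN.
have irr := tandem_irreducible lambda_gt0 mu1_gt0 mu2_gt0 nu0.
split => //.
- by move=> x x01 tx; exact: tau_zero_unique tx tau_eta.
- exact: bounded_rates_transition L_gt0 q_ge0 q_diag q_bounded.
have zn0 n : 0 < z ^+ n by rewrite exprn_gt0.
have [c [W [c0 W0 sW mass]]] := product_normalization zn0 wpos
  (fun n => geometric_sum_le n z01)
  (w_partial_sum_le lambda_gt0 lambda_mu1 mu1_mu2 z_gt0 mu2z_le disc w0 w1 wS).
pose p (x : nat * nat) := c * z ^+ x.1 * w x.2.
have p0 x : 0 <= p x by rewrite !mulr_ge0// ltW.
have balp : global_balance q p.
  exact: (product_form_balance lambda_gt0 mu1_gt0 mu2_gt0 nu0 z_gt0 wpos w0 w1 wS nu1 nuS (ltW c0)).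
exists c => P tfP.
have stat pi : stationary_distribution P pi <-> pi = p.
  split=> [sd|->].
    have [pi0 pi1 _] := sd.
    apply: (balance_unique L_gt0 q_ge0 q_bounded irr) => //.
    exact/(stationary_iff_balance L_gt0 q_ge0 q_diag q_bounded tfP pi0 pi1).
  exact/(stationary_iff_balance L_gt0 q_ge0 q_diag q_bounded tfP p0 mass).
split=> pi; first split.
- by move=> /stat -> n j.
- by move=> piE; apply/stat/funext => -[n j]; exact: piE.
move=> /stat ->; rewrite /has_decay_rate.
have q2 n : queue2_distribution p n = c * z ^+ n * W.
  apply: (queue2_product (f := fun n => z ^+ n)) => //; first exact: ltW.
  - by move=> m; exact: ltW.
  - by move=> m; exact: ltW.
rewrite (_ : (fun n => _) = fun=> z); first exact: cvg_cst.
apply/funext => n; rewrite !q2 exprS; field.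
by rewrite !gt_eqF.
Qed.
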